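(* Let $n\ge2$, let $K\subset\mathbb R^n$ be a nonempty smoothly bounded compact set, and let $M=\mathbb R^n\setminus K$. Let $\lambda>0$, $\beta>0$ and $p\in\bigl(1,1+\frac4{n-2}\bigr)$ (i.e. $p\in(1,\infty)$ if $n=2$). Set $$I_\beta(M)=\inf\{F_\lambda(u):u\in H^1_0(M),\ J_p(u)=\beta\}.$$ Then there does not exist $u\in H^1_0(M)$ such that $J_p(u)=\beta$ and $F_\lambda(u)=I_\beta(M)$.
   Context: ''Smoothly bounded compact set'' means the closure of a bounded open set with smooth boundary. $F_\lambda(u)=\|\nabla u\|_{L^2}^2+\lambda\|u\|_{L^2}^2$ and $J_p(u)=\int_M|u|^{p+1}\,dV$. $H^1_0(M)$ consists of complex-valued functions and corresponds to the Dirichlet boundary condition on $\partial M$. *)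

(* Defs.v *)
From HB Require Import structures.
From mathcomp Require Import all_boot all_order all_algebra.
From mathcomp Require Import all_classical all_reals all_analysis.
From mathcomp Require Import complex.

Set Implicit Arguments.
Unset Strict Implicit.
Unset Printing Implicit Defensive.

Import Order.TTheory GRing.Theory Num.Theory.
Import numFieldNormedType.Exports.

Local Open Scope classical_set_scope.
Local Open Scope ring_scope.

Definition rV_display : measure_display.
Proof. exact: default_measure_display. Qed.

(* The sigma-algebra on R^n generated by the coordinate maps, which is the
   Borel sigma-algebra. *)
Section measurable_rV.
Context {R : realType} {n : nat}.

Let coord : 'I_n -> 'rV[R]_n -> R := fun i x => x ord0 i.

Let rV_set0 : g_sigma_preimage coord set0.
Proof. exact: sigma_algebra0. Qed.

Let rV_setC A : g_sigma_preimage coord A -> g_sigma_preimage coord (~` A).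
Proof. exact: sigma_algebraC. Qed.

Let rV_bigcup (F : (set 'rV[R]_n)^nat) :
  (forall i, g_sigma_preimage coord (F i)) ->
  g_sigma_preimage coord (\bigcup_i (F i)).
Proof. exact: sigma_algebra_bigcup. Qed.

HB.instance Definition _ := @isMeasurable.Build rV_display
  'rV[R]_n (g_sigma_preimage coord) rV_set0 rV_setC rV_bigcup.

Lemma measurable_coord (i : 'I_n) :
  measurable_fun [set: 'rV[R]_n] (fun x : 'rV[R]_n => x ord0 i).
Proof.
move=> _ Y mY; rewrite setTI; apply: sub_sigma_algebra => /=.
rewrite -bigcup_seq/=; exists i => /=; first by rewrite mem_index_enum.
by exists Y => //; rewrite setTI.
Qed.

Lemma measurable_fun_rV d (T : measurableType d) (f : T -> 'rV[R]_n) :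
  (forall i, measurable_fun [set: T] (fun x => f x ord0 i)) ->
  measurable_fun [set: T] f.
Proof.
move=> mf _ A mA; rewrite setTI.
pose S := [set B : set 'rV[R]_n | measurable (f @^-1` B)].
suff : g_sigma_preimage coord `<=` S by apply; exact: mA.
apply: smallest_sub.
  split => [|B|F]; rewrite /S/=.
  - by rewrite preimage_set0; exact: measurable0.
  - by move=> mB; rewrite setTD preimage_setC; exact: measurableC.
  - by move=> mF; rewrite preimage_bigcup; exact: bigcup_measurable.
rewrite -bigcup_seq => B [i _ [C mC <-]] /=.
rewrite setTI /S/= -comp_preimage.
by have := mf i measurableT _ mC; rewrite setTI.
Qed.

End measurable_rV.

(* Lebesgue measure on R^n, by R^(n+1) = R x R^n. *)
Section lebesgue_rV.
Context {R : realType}.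

Definition rV_cons n (p : measurableTypeR R * 'rV[R]_n) : 'rV[R]_n.+1 :=
  row_mx (p.1 : R)%:M p.2.

Definition rV_uncons n (x : 'rV[R]_n.+1) : measurableTypeR R * 'rV[R]_n :=
  (x ord0 ord0, \row_j x ord0 (lift ord0 j)).

Lemma rV_consE n (p : measurableTypeR R * 'rV[R]_n) (i : 'I_n.+1) :
  rV_cons p ord0 i = if unlift ord0 i is Some j then p.2 ord0 j else p.1.
Proof.
rewrite /rV_cons; case: unliftP => [j ->|->].
  have -> : lift ord0 j = rshift 1 j by apply/val_inj.
  by rewrite (row_mxEr (p.1 : R)%:M p.2).
have -> : (ord0 : 'I_n.+1) = lshift n (ord0 : 'I_1) by apply/val_inj.
by rewrite (row_mxEl (p.1 : R)%:M p.2) mxE eqxx.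
Qed.

Lemma rV_consK n : cancel (@rV_cons n) (@rV_uncons n).
Proof.
move=> [a v]; rewrite /rV_uncons rV_consE unlift_none; congr pair.
by apply/rowP => j; rewrite mxE rV_consE liftK.
Qed.

Lemma measurable_rV_cons n : measurable_fun setT (@rV_cons n).
Proof.
apply: measurable_fun_rV => i; under eq_fun do rewrite rV_consE.
case: unliftP => [j _|_]; last exact: measurable_fst.
by apply: (measurableT_comp (measurable_coord j)); exact: measurable_snd.
Qed.

Lemma measurable_rV_uncons n : measurable_fun setT (@rV_uncons n).
Proof.
apply: measurable_fun_pair; first exact: measurable_coord.
apply: measurable_fun_rV => i; under eq_fun do rewrite mxE.
exact: measurable_coord.
Qed.

Section step.
Variables (n : nat) (m : {sigma_finite_measure set 'rV[R]_n -> \bar R}).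

Definition lebesgue_rV_step : set 'rV[R]_n.+1 -> \bar R :=
  pushforward (@lebesgue_measure R \x m)%E (@rV_cons n).

Let step0 : lebesgue_rV_step set0 = 0%E.
Proof. by rewrite /lebesgue_rV_step /pushforward preimage_set0 measure0. Qed.

Let step_ge0 A : (0 <= lebesgue_rV_step A)%E.
Proof. exact: (measure_ge0 (@lebesgue_measure R \x m)%E). Qed.

Let step_sigma_additive : semi_sigma_additive lebesgue_rV_step.
Proof.
pose mcons := @measurable_rV_cons n.
exact: (@measure_semi_sigma_additive _ _ _
  (measure_function_pushforward__canonical__measure_function_Measure
    (@lebesgue_measure R \x m)%E mcons)).
Qed.

HB.instance Definition _ := isMeasure.Build _ _ _ lebesgue_rV_step
  step0 step_ge0 step_sigma_additive.

Let step_sigma_finite : sigma_finite setT lebesgue_rV_step.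
Proof.
have /sigma_finiteP[F [TF ndF Foo]] := sigma_finiteT (@lebesgue_measure R).
have /sigma_finiteP[G [TG ndG Goo]] := sigma_finiteT m.
exists (fun k => @rV_uncons n @^-1` (F k `*` G k)).
  rewrite -preimage_bigcup (_ : \bigcup_i _ = setT) ?preimage_setT//.
  rewrite -setXTT TF TG predeqE => -[x y]; split.
    by move=> [k _ []/= ? ?]; split; exists k.
  move=> [/= [k _ Fkx] [l _ Gly]]; exists (maxn k l) => //; split.
  - by move: x Fkx; exact/subsetPset/ndF/leq_maxl.
  - by move: y Gly; exact/subsetPset/ndG/leq_maxr.
move=> k; have [mF Fk] := Foo k; have [mG Gk] := Goo k; split.
  rewrite -[X in measurable X]setTI; apply: measurable_rV_uncons => //.
  exact: measurableX.
rewrite /lebesgue_rV_step /pushforward -comp_preimage.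
rewrite (_ : _ \o _ = id); last by apply/funext => p; exact: rV_consK.
rewrite preimage_id product_measure1E// lte_mul_pinfty//.
by rewrite ge0_fin_numE.
Qed.

HB.instance Definition _ := Measure_isSigmaFinite.Build _ _ _ lebesgue_rV_step
  step_sigma_finite.

End step.

Fixpoint lebesgue_rV n : {sigma_finite_measure set 'rV[R]_n -> \bar R} :=
  match n with
  | 0 => dirac (0 : 'rV[R]_0)
  | n'.+1 => lebesgue_rV_step (lebesgue_rV n')
  end.

Lemma measurable_box n (A : 'I_n -> set R) : (forall i, measurable (A i)) ->
  measurable [set x : 'rV[R]_n | forall i, A i (x ord0 i)].
Proof.
move=> mA; rewrite (_ : [set _ | _] =
    \bigcap_(i in [set: 'I_n]) ((fun x : 'rV[R]_n => x ord0 i) @^-1` A i)).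
  apply: fin_bigcap_measurable => // i _.
  by rewrite -[X in measurable X]setTI;
    exact: (measurable_coord i measurableT (mA i)).
by apply/seteqP; split => x /= h i; [move=> _; exact: h|exact: h].
Qed.

Lemma open_measurable_rV n (U : set 'rV[R]_n) : open U -> measurable U.
Proof.
rewrite openE => oU.
pose c (i : 'rV[rat]_n * nat) : 'rV[R]_n := map_mx ratr i.1.
pose B i : set 'rV[R]_n := ball (c i) i.2.+1%:R^-1.
rewrite (_ : U = \bigcup_i (if `[< B i `<=` U >] then B i else set0)).
  apply: countable_bigcupT_measurable => [|i]; first exact: countableP.
  case: ifPn => // _.
  rewrite (_ : B i =
      [set x | forall j, ball (c i ord0 j) i.2.+1%:R^-1 (x ord0 j)]).
    apply: (measurable_box (A := fun j => ball (c i ord0 j) i.2.+1%:R^-1)) => j.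
    by rewrite ball_itv; exact: measurable_itv.
  apply/seteqP; split => x /=; first by move=> [_ h] j; exact: h.
  by move=> h; split => // k j; rewrite (ord1 k); exact: h.
apply/seteqP; split => [x Ux|x [i _]]; last first.
  by case: ifPn => // /asboolP; exact.
have /nbhs_ballP[e /= e0 xeU] := oU _ Ux.
have e20 : 0 < e / 2 by rewrite divr_gt0.
have [k ke] : exists k : nat, k.+1%:R^-1 < e / 2.
  exists (Num.truncn (e / 2)^-1).
  rewrite invf_plt ?posrE//; exact: truncnS_gt.
pose d : R := k.+1%:R^-1.
have d0 : 0 < d by rewrite invr_gt0.
have /choice[q qP] (j : 'I_n) : exists q : rat, `|ratr q - x ord0 j| < d.
  have : x ord0 j < x ord0 j + d by rewrite ltrDl.
  move=> /rat_in_itvoo[q]; rewrite in_itv/= => /andP[xq qx].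
  by exists q; rewrite gtr0_norm ?subr_gt0// ltrBlDl.
pose i : 'rV[rat]_n * nat := (\row_j q j, k).
have Bi y : B i y <-> forall j, `|ratr (q j) - y ord0 j| < d.
  split; first by move=> [_ h] j; have := h ord0 j; rewrite /ball/= !mxE.
  by move=> h; split => // l j; rewrite (ord1 l) /ball/= !mxE; exact: h.
exists i => //; case: asboolP => [_|]; first exact/Bi.
case=> y /Bi By; apply: xeU; split => // l j; rewrite (ord1 l) /ball/=.
rewrite -(subrKA (ratr (q j))) (le_lt_trans (ler_normD _ _))//.
rewrite [e]splitr; apply: ltrD; apply: lt_trans ke; last exact: By.
by rewrite distrC; exact: qP.
Qed.

Lemma lebesgue_rV_box n (A : 'I_n -> set R) : (forall i, measurable (A i)) ->
  lebesgue_rV n [set x : 'rV[R]_n | forall i, A i (x ord0 i)] =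
  (\prod_(i < n) lebesgue_measure (A i : set (measurableTypeR R)))%E.
Proof.
elim: n A => [|n IHn] A mA.
  by rewrite big_ord0 /= diracE mem_set//= => -[].
rewrite big_ord_recl -IHn//= /lebesgue_rV_step /pushforward.
rewrite -product_measure1E; [|exact: mA|]; last first.
  by apply: (@measurable_box _ (fun i => A (lift ord0 i))).
congr (product_measure1 _ _ _); apply/seteqP; split => p /=.
- move=> h; split=> [|i].
    by have := h ord0; rewrite rV_consE unlift_none.
  by have := h (lift ord0 i); rewrite rV_consE liftK.
- move=> [h0 h] i; rewrite rV_consE.
  by case: unliftP => [j ->|->//]; exact: h.
Qed.

End lebesgue_rV.

Section smooth.
Context {R : realType} {n : nat}.
Implicit Types (f : 'rV[R]_n -> R) (U : set 'rV[R]_n) (s : seq 'I_n).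

Definition partial (i : 'I_n) f : 'rV[R]_n -> R :=
  fun x => 'D_(delta_mx ord0 i) f x.

Definition partials s f : 'rV[R]_n -> R := foldr partial f s.

(* f is C^oo on the open set U. *)
Definition smooth_on U f := forall s x, U x ->
  {for x, continuous (partials s f)} /\
  forall i : 'I_n, derivable (partials s f) x (delta_mx ord0 i).

(* Near each boundary point, the open set Omega is {rho < 0} for a smooth rho
   with nowhere vanishing gradient. *)
Definition smooth_boundary (Omega : set 'rV[R]_n) :=
  forall x, (closure Omega `\` Omega) x ->
  exists U (rho : 'rV[R]_n -> R),
    [/\ open U, U x, smooth_on U rho,
        forall y, U y -> exists i, partial i rho y != 0 &
        Omega `&` U = [set y | rho y < 0] `&` U].

Definition smoothly_bounded_compact (K : set 'rV[R]_n) :=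
  exists Omega : set 'rV[R]_n,
    [/\ open Omega, bounded_set Omega, smooth_boundary Omega &
        K = closure Omega].

End smooth.

(* A function on M is a total function on R^n of which only the values on M
   matter, and a.e. classes are handled through representatives. *)
Section sobolev.
Local Notation normc := ComplexField.Normc.normc.
Context {R : realType} {n : nat}.
Implicit Types (M : set 'rV[R]_n) (u v phi : 'rV[R]_n -> R[i]).
Implicit Types (g : 'I_n -> 'rV[R]_n -> R[i]).

Definition cpartial (i : 'I_n) phi : 'rV[R]_n -> R[i] := fun x =>
  Complex (partial i (@complex.Re R \o phi) x)
          (partial i (@complex.Im R \o phi) x).

Definition cintegral M u : R[i] :=
  Complex (\int[lebesgue_rV n]_(x in M) complex.Re (u x))
          (\int[lebesgue_rV n]_(x in M) complex.Im (u x)).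

Definition test_function M phi :=
  [/\ smooth_on setT (@complex.Re R \o phi),
      smooth_on setT (@complex.Im R \o phi) &
      exists C, [/\ compact C, C `<=` M & forall x, ~ C x -> phi x = 0]].

Definition L2norm_sqr M u : \bar R :=
  (\int[lebesgue_rV n]_(x in M) (normc (u x) ^+ 2)%:E)%E.

Definition L2 M u :=
  [/\ measurable_fun M (@complex.Re R \o u),
      measurable_fun M (@complex.Im R \o u) &
      (L2norm_sqr M u < +oo)%E].

Definition weak_partial M (i : 'I_n) u v := forall phi, test_function M phi ->
  cintegral M (fun x => u x * cpartial i phi x) =
  - cintegral M (fun x => v x * phi x).

Definition weak_grad M u : set ('I_n -> 'rV[R]_n -> R[i]) :=
  [set g | forall i, L2 M (g i) /\ weak_partial M i u (g i)].

Definition H1 M u := L2 M u /\ weak_grad M u !=set0.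

(* The weak gradient, which is unique up to a.e. equality. *)
Definition nabla M u : 'I_n -> 'rV[R]_n -> R[i] :=
  xget (fun _ _ => 0) (weak_grad M u).

Definition grad_norm_sqr M g : \bar R :=
  (\int[lebesgue_rV n]_(x in M)
    (\sum_(i < n) normc (g i x) ^+ 2)%:E)%E.

(* H^1_0(M), the closure of C_c^oo(M) in H^1(M). *)
Definition H10 M u := H1 M u /\
  forall e : R, 0 < e -> exists2 phi, test_function M phi &
    (L2norm_sqr M (u \- phi)%R
     + grad_norm_sqr M (fun i => nabla M u i \- cpartial i phi)%R < e%:E)%E.

Definition F_ (lambda : R) M u : \bar R :=
  (grad_norm_sqr M (nabla M u) + lambda%:E * L2norm_sqr M u)%E.

Definition J_ (p : R) M u : \bar R :=
  (\int[lebesgue_rV n]_(x in M)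
    (normc (u x) `^ (p + 1))%:E)%E.

Definition I_ (lambda p beta : R) M : \bar R :=
  ereal_inf [set F_ lambda M u | u in [set u | H10 M u /\ J_ p M u = beta%:E]].

End sobolev.

(* Main.v *)
Require Import Defs.
From HB Require Import structures.
From mathcomp Require Import all_boot all_order all_algebra.
From mathcomp Require Import all_classical all_reals all_analysis.
From mathcomp Require Import complex measurable_realfun.
From mathcomp Require Import ring lra.
Set Implicit Arguments.
Unset Strict Implicit.
Unset Printing Implicit Defensive.
Import Order.TTheory GRing.Theory Num.Theory.
Import numFieldNormedType.Exports.
Local Open Scope classical_set_scope.
Local Open Scope ring_scope.

(** The infimum over [M] is at most the energy of every real function of
    C_c^oo(R^n) whose mass is [beta]: since [K] is bounded, such a function can
    be translated off [K], which changes neither its energy nor its mass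
    ([I_le_energy]).  On the other hand an element of H^1_0(M), extended by 0,
    vanishes on [K], which contains a ball.  A minimizer would therefore
    minimize over the whole space and vanish on a ball, against the strong
    maximum principle.

    The maximum principle enters as follows.  Adding a nonnegative function to
    a nonnegative one increases the mass, and scaling the result down to mass
    [beta] decreases the energy ([energy_lower_bound]).  So, if [w] is the
    modulus of a minimizer [u] extended by 0, the energy of [w + t psi] is at
    least that of [w] for all [t > 0] and [psi >= 0] in C_c^oo(R^n), and to
    first order in [t] this reads: the integral of
    [w * (lambda psi - Laplacian psi)] is nonnegative, that is, [w] is a weak
    supersolution in all of R^n.  If the ball of radius [r] around [z] is
    contained in [K], Hopf's barrier ([barrier]) is a [psi] for which
    [lambda psi - Laplacian psi] is nonpositive outside that ball and negative
    on the part of its complement where [|x - z|^2 < S].  As [w] vanishes in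
    the ball, the integral is also nonpositive, so it is zero
    ([minimizer_supersolution]) and [u] vanishes almost everywhere on that
    part.  Since [S] is arbitrary, [u = 0], and its mass is not [beta].

    The first-order argument needs a smooth compactly supported substitute for
    [|u|].  Test functions [phi_k] converge to [u] in H^1 with summable errors;
    then [a_k = sqrt (|phi_k|^2 + eps_k^2) - eps_k] is a test function,
    [|grad a_k| <= |grad phi_k|] and [a_k] tends to [|u|] almost everywhere
    ([modulus_sequence]).  What is needed of [a_k] besides the upper bound of
    its energy are lower bounds of two integrals of nonnegative functions, its
    mass and the integral of [a_k * (Laplacian psi - lambda psi)] over [M];
    Fatou's lemma provides both ([fatou_lower]).

    The energy is defined through a choice of a weak gradient, so competitors
    are only useful once the weak gradient of a test function is known to be
    the classical one ([weak_grad_unique]).  This rests on integration by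
    parts, which follows from the translation invariance of the Lebesgue
    measure ([integral_partial]), and on the fundamental lemma of the calculus
    of variations ([ae_eq0_test]), which is proved with bumps on boxes and the
    pi-lambda theorem. *)

(** * Smooth functions on R^n *)
Section directional_derivative.
Context {R : realType} {V : normedModType R}.

Lemma is_derive_line (f : V -> R) (x v : V) (d : R) :
  is_derive x v f d <-> is_derive (0 : R) 1 (fun t : R => f (t *: v + x)) d.
Proof.
have e : 'D_v f x = 'D_1 (fun t : R => f (t *: v + x)) (0 : R).
  rewrite /derive; set g1 := fun h => h^-1 *: _; set g2 := fun h => h^-1 *: _.
  suff -> : g1 = g2 by [].
  by rewrite funeqE /g1 /g2 => h /=; rewrite addr0 scale0r add0r [_%:A]mulr1.
split=> -[df fd].
  by apply: DeriveDef; [exact: (derivable1P f x v).1 df|rewrite -e].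
by apply: DeriveDef; [exact: (derivable1P f x v).2 df|rewrite e].
Qed.

(** The chain rule without differentiability of [f]: along the line
    [x + t v] it is the chain rule in one variable. *)
Lemma is_derive_comp1 (h : R -> R) (f : V -> R) (x v : V) (dh d : R) :
  is_derive (f x) (1 : R) h dh -> is_derive x v f d ->
  is_derive x v (h \o f) (dh * d).
Proof.
move=> hh /is_derive_line hf; apply/is_derive_line.
rewrite (_ : (fun _ => _) = h \o (fun t : R => f (t *: v + x)))//.
apply: (@is_derive1_comp R h (fun t : R => f (t *: v + x)) 0 dh d) => //.
by rewrite scale0r add0r.
Qed.

End directional_derivative.

Section smooth_calculus.
Context {R : realType} {n : nat}.
Local Notation V := 'rV[R]_n.
Local Notation dir i := (delta_mx ord0 i : 'rV[R]_n).
Implicit Types (f g : V -> R) (A : set (V -> R)).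

(** [smooth_on] speaks of all iterated partial derivatives, which are
    intractable one by one for a composite function.  The algebra generated by
    a set [A] of functions is where they live: by the Leibniz rule it is stable
    under partial derivatives as soon as it contains those of the generators. *)
Inductive generated A : (V -> R) -> Prop :=
| generated_base f : A f -> generated A f
| generated_cst (c : R) : generated A (cst c)
| generated_add f g : generated A f -> generated A g -> generated A (f \+ g)
| generated_mul f g : generated A f -> generated A g -> generated A (f \* g).

(** This reduces every smoothness proof below to the first partial derivatives
    of a few generators. *)
Lemma generated_smooth A f :
  (forall g, A g -> continuous g /\ forall i, exists2 d, generated A d &
     forall x, is_derive x (dir i) g (d x)) ->
  generated A f -> smooth_on setT f.
Proof.
move=> HA.
have H g : generated A g -> continuous g /\ forall i, exists2 d, generated A d &
     forall x, is_derive x (dir i) g (d x).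
  elim=> [{}g /HA//|c|{}f {}g _ [cf df] _ [cg dg]|{}f {}g gf [cf df] gg [cg dg]].
  - split=> [|i]; first exact: cst_continuous.
    by exists (cst 0); [exact: generated_cst|move=> x; exact: is_derive_cst].
  - split=> [x|i]; first by apply: continuousD; [exact: cf|exact: cg].
    have [a Aa ha] := df i; have [b Ab hb] := dg i.
    exists (a \+ b); first exact: generated_add.
    by move=> x; exact: (is_deriveD (ha x) (hb x)).
  - split=> [x|i]; first by apply: continuousM; [exact: cf|exact: cg].
    have [a Aa ha] := df i; have [b Ab hb] := dg i.
    exists ((f \* b) \+ (g \* a)).
      by apply: generated_add; exact: generated_mul.
    by move=> x; exact: (is_deriveM (ha x) (hb x)).
have HP i g : generated A g -> generated A (partial i g).
  move=> /H[_ /(_ i)[d Ad hd]].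
  suff -> : partial i g = d by [].
  by apply/funext => x; rewrite /partial; have [_ ->] := hd x.
move=> gf s x _.
have {}gf : generated A (partials s f) by elim: s => //= i s; exact: HP.
have [cf df] := H _ gf; split; first exact: cf.
by move=> i; have [d _ /(_ x)[]] := df i.
Qed.

Lemma smooth_base f : smooth_on setT f -> continuous f /\
  forall i, smooth_on setT (partial i f) /\
    forall x, is_derive x (dir i) f (partial i f x).
Proof.
move=> sf; split=> [x|i]; first by have [] := sf [::] x I.
split=> [s x _|x]; last by apply: derivableP; have [_] := sf [::] x I; exact.
have := sf (rcons s i) x I; rewrite /partials -cats1 foldr_cat; exact.
Qed.

Lemma smooth_continuous f : smooth_on setT f -> continuous f.
Proof. by case/smooth_base. Qed.

Lemma smooth_partial i f : smooth_on setT f -> smooth_on setT (partial i f).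
Proof. by move=> /smooth_base[_ /(_ i)[]]. Qed.

Lemma smooth_is_derive f i x :
  smooth_on setT f -> is_derive x (dir i) f (partial i f x).
Proof. by move=> /smooth_base[_ /(_ i)[]]. Qed.

Lemma smooth_generators f : smooth_on setT f -> continuous f /\ forall i,
  exists2 d, generated (smooth_on setT) d &
     forall x, is_derive x (dir i) f (d x).
Proof.
move=> /smooth_base[cf df]; split => // i; have [h1 h2] := df i.
by exists (partial i f) => //; exact: generated_base.
Qed.

Lemma smooth_cst (c : R) : smooth_on setT (cst c : V -> R).
Proof.
apply: (generated_smooth (A := smooth_on setT)); first exact: smooth_generators.
exact: generated_cst.
Qed.

Lemma smoothD f g : smooth_on setT f -> smooth_on setT g ->
  smooth_on setT (f \+ g).
Proof.
move=> sf sg.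
apply: (generated_smooth (A := smooth_on setT)); first exact: smooth_generators.
by apply: generated_add; exact: generated_base.
Qed.

Lemma smoothM f g : smooth_on setT f -> smooth_on setT g ->
  smooth_on setT (f \* g).
Proof.
move=> sf sg.
apply: (generated_smooth (A := smooth_on setT)); first exact: smooth_generators.
by apply: generated_mul; exact: generated_base.
Qed.

Lemma smoothZ (c : R) f : smooth_on setT f -> smooth_on setT (fun x => c * f x).
Proof. by move=> sf; exact: (smoothM (smooth_cst c) sf). Qed.

Lemma smooth_sum (I : Type) (r : seq I) (F : I -> V -> R) :
  (forall i, smooth_on setT (F i)) ->
  smooth_on setT (fun x => \sum_(i <- r) F i x).
Proof.
move=> sF; elim: r => [|i r IH].
  by under eq_fun do rewrite big_nil; exact: smooth_cst.
by under eq_fun do rewrite big_cons; exact: (smoothD (sF i) IH).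
Qed.

Lemma smooth_prod (I : Type) (r : seq I) (F : I -> V -> R) :
  (forall i, smooth_on setT (F i)) ->
  smooth_on setT (fun x => \prod_(i <- r) F i x).
Proof.
move=> sF; elim: r => [|i r IH].
  by under eq_fun do rewrite big_nil; exact: smooth_cst.
by under eq_fun do rewrite big_cons; exact: (smoothM (sF i) IH).
Qed.

Lemma is_derive_coord (i j : 'I_n) (x : V) :
  is_derive x (dir i) (fun y => y ord0 j) ((j == i)%:R : R).
Proof.
apply/is_derive_line.
rewrite (_ : (fun _ => _) = ((j == i)%:R \*: (id : R -> R) + cst (x ord0 j))).
  rewrite -[X in is_derive _ _ _ X]addr0 -[X in is_derive _ _ _ (X + _)]mulr1.
  exact: (is_deriveD (is_deriveZ (j == i)%:R (is_derive_id (0 : R) (1 : R)))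
    (is_derive_cst (x ord0 j) (0 : R) (1 : R))).
by apply/funext => t; rewrite !mxE /= mulrC.
Qed.

Lemma smooth_coord (j : 'I_n) : smooth_on setT (fun x : V => x ord0 j).
Proof.
apply: (generated_smooth (A := [set fun x : V => x ord0 j])) => [_ ->|].
  split=> [x|i]; first exact: coord_continuous.
  exists (cst (j == i)%:R); first exact: generated_cst.
  by move=> x; exact: is_derive_coord.
exact: generated_base.
Qed.

Lemma partialE f i (d : V -> R) :
  (forall x, is_derive x (dir i) f (d x)) -> partial i f = d.
Proof. by move=> h; apply/funext => x; have [_ <-] := h x. Qed.

Lemma partialD f g i : smooth_on setT f -> smooth_on setT g ->
  partial i (f \+ g) = partial i f \+ partial i g.
Proof.
move=> sf sg; apply: partialE => x.
exact: (is_deriveD (smooth_is_derive i x sf) (smooth_is_derive i x sg)).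
Qed.

Lemma partialM f g i : smooth_on setT f -> smooth_on setT g ->
  partial i (f \* g) = (f \* partial i g) \+ (g \* partial i f).
Proof.
move=> sf sg; apply: partialE => x.
exact: (is_deriveM (smooth_is_derive i x sf) (smooth_is_derive i x sg)).
Qed.

Lemma partial_cst (c : R) i : partial i (cst c : V -> R) = cst 0.
Proof. by apply: partialE => x; exact: is_derive_cst. Qed.

Lemma partialZ (c : R) f i : smooth_on setT f ->
  partial i (fun x => c * f x) = (fun x => c * partial i f x).
Proof.
move=> sf; rewrite (@partialM (cst c) f i (smooth_cst c) sf) partial_cst.
by apply/funext => x /=; rewrite mulr0 addr0.
Qed.

Lemma is_derive_translate f (h x v : V) d :
  is_derive (x + h) v f d -> is_derive x v (fun y => f (y + h)) d.
Proof.
move=> /is_derive_line H; apply/is_derive_line.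
by under eq_fun do rewrite -addrA.
Qed.

Lemma partial_translate f i (h : V) : smooth_on setT f ->
  partial i (fun x => f (x + h)) = (fun x => partial i f (x + h)).
Proof.
by move=> sf; apply: partialE => x; apply/is_derive_translate/smooth_is_derive.
Qed.

Lemma continuous_translate (h : V) : continuous (fun x : V => x + h).
Proof. by move=> x; exact: (cvgD (@cvg_id _ (nbhs x)) (cvg_cst h)). Qed.

Lemma smooth_translate f (h : V) : smooth_on setT f ->
  smooth_on setT (fun x => f (x + h)).
Proof.
move=> sf.
pose A := [set g : V -> R |
  exists2 g0, smooth_on setT g0 & g = fun x => g0 (x + h)].
apply: (generated_smooth (A := A)); last by apply: generated_base; exists f.
move=> _ [g sg ->]; split=> [x|i].
  change {for x, continuous (g \o (fun y : V => y + h))}.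
  by apply: continuous_comp; [exact: continuous_translate|exact: smooth_continuous].
exists (fun x => partial i g (x + h)).
  by apply: generated_base; exists (partial i g); [exact: smooth_partial|].
by move=> x; apply/is_derive_translate/smooth_is_derive.
Qed.

End smooth_calculus.

(** * Flat functions *)
Section flat_functions.
Context {R : realType}.
Variable al : R.
Hypothesis al0 : 0 < al.

(** For [k = 0] this is the standard smooth function [exp (- al / s)] that is
    flat at 0.  The family over all [k] is closed under differentiation, up to
    linear combinations. *)
Definition flat k (s : R) : R :=
  if 0 < s then s^-1 ^+ k * expR (- (al * s^-1)) else 0.

Lemma flat_gt0 k s : 0 < s -> 0 < flat k s.
Proof.
by move=> s0; rewrite /flat s0 mulr_gt0 ?expR_gt0// exprn_gt0// invr_gt0.
Qed.

Lemma flat_ge0 k s : 0 <= flat k s.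
Proof. by have [/(flat_gt0 k)/ltW//|s0] := ltP 0 s; rewrite /flat ltNge s0. Qed.

Lemma flat_eq0 k s : s <= 0 -> flat k s = 0.
Proof. by rewrite /flat ltNge => ->. Qed.

Lemma flatS k s : 0 < s -> flat k s = s * flat k.+1 s.
Proof. by move=> s0; rewrite /flat s0 exprS !mulrA divff ?mul1r// gt_eqF. Qed.

(** Any bound of order above 1 at 0 gives differentiability there; this one
    holds because the exponential dominates the [k.+2]-th power. *)
Lemma flat_quadratic k : exists2 C, 0 < C & forall s, `|flat k s| <= C * s ^+ 2.
Proof.
exists (k.+2`!%:R / al ^+ k.+2).
  by rewrite divr_gt0 ?exprn_gt0// ltr0n fact_gt0.
move=> s; rewrite ger0_norm ?flat_ge0//.
have [s0|s0] := ltP 0 s; last first.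
  by rewrite flat_eq0// mulr_ge0 ?sqr_ge0// divr_ge0// ltW// exprn_gt0.
rewrite /flat s0 expRN.
set y := al * s^-1; have y0 : 0 < y by rewrite mulr_gt0// invr_gt0.
have h := @expR_ge1Dxn _ y k.+1 (ltW y0).
have h2 : y ^+ k.+2 / k.+2`!%:R <= expR y.
  by rewrite (le_trans _ h)// lerDr.
have -> : k.+2`!%:R / al ^+ k.+2 * s ^+ 2 = s^-1 ^+ k * (y ^+ k.+2 / k.+2`!%:R)^-1.
  have e : s ^+ k.+2 = s ^+ k * s ^+ 2 by rewrite -exprD addn2.
  rewrite /y exprMn !exprVn e.
  by field; rewrite !expf_neq0 ?gt_eqF//= ltr0n fact_gt0.
rewrite ler_pM2l ?exprn_gt0 ?invr_gt0// lef_pV2 ?posrE ?expR_gt0//.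
by rewrite divr_gt0 ?exprn_gt0// ltr0n fact_gt0.
Qed.

Lemma is_derive_quadratic (f : R -> R) C : 0 < C ->
  (forall s, `|f s| <= C * s ^+ 2) -> is_derive (0 : R) 1 f 0.
Proof.
move=> C0 fC.
have f0 : f 0 = 0.
  by apply/eqP; rewrite -normr_le0 (le_trans (fC 0))// expr2 !mulr0.
have H : (fun h => h^-1 *: ((f \o shift 0) (h *: 1) - f 0)) @ 0^' --> (0 : R).
  apply/cvgrPdist_le => e e0; near=> h.
  have h0 : h != 0 by near: h; exact: nbhs_dnbhs_neq.
  rewrite sub0r normrN /= f0 subr0 addr0 [h *: 1]mulr1 normrM normfV.
  rewrite ler_pdivrMl ?normr_gt0//.
  rewrite (le_trans (fC h))// -real_normK ?num_real// expr2 mulrCA ler_wpM2l//.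
  rewrite -ler_pdivlMl//; near: h; apply: dnbhs0_le.
  by rewrite mulr_gt0// invr_gt0.
split; first by apply/cvg_ex; exists 0.
exact: (cvg_lim _ H).
Unshelve. all: by end_near. Qed.

Lemma is_derive_flat k s :
  is_derive s (1 : R) (flat k) (al * flat k.+2 s - k%:R * flat k.+1 s).
Proof.
have [s0|s0|->] := ltgtP s 0.
- rewrite !flat_eq0 ?ltW// !mulr0 subrr.
  apply: (@near_eq_is_derive _ _ _ (cst (0 : R))).
  near=> t; rewrite /= flat_eq0// ltW//.
  by near: t; exact: lt_nbhsl.
- apply: (@near_eq_is_derive _ _ _
    (((fun t : R => t^-1) ^+ k) \* (expR \o (fun t => - al * t^-1)))).
    near=> t; rewrite /flat ifT /=; last by near: t; exact: lt_nbhsr.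
    by rewrite exprfctE mulNr.
  have dV : is_derive s (1 : R) (fun t : R => t^-1) (- s ^- 2).
    by rewrite -[- _]mulr1; apply: (@is_deriveV _ id) => //; rewrite gt_eqF.
  have dX := is_deriveX k dV.
  have dA := @is_derive1_comp _ expR (- al \*: (fun t : R => t^-1)) s _ _
    (is_derive_expR _) (is_deriveZ (- al) dV).
  apply: (is_derive_eq (is_deriveM dX dA)).
  rewrite exprfctE /flat s0 /= /GRing.scale /= -!mulNr.
  rewrite -exprVn; set E := expR _; set w := s^-1.
  by case: k {dX} => [|k] /=; [ring|rewrite !exprS; ring].
- rewrite !flat_eq0// !mulr0 subrr.
  by have [C C0 fC] := flat_quadratic k; exact: is_derive_quadratic fC.
Unshelve. all: by end_near. Qed.

Lemma continuous_flat k : continuous (flat k).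
Proof.
move=> s; apply/differentiable_continuous/derivable1_diffP.
by have [] := is_derive_flat k s.
Qed.

End flat_functions.

Section smooth_composites.
Context {R : realType} {n : nat}.
Local Notation V := 'rV[R]_n.
Local Notation dir i := (delta_mx ord0 i : 'rV[R]_n).
Implicit Types (f g : V -> R).

Lemma is_derive_flat_comp al (al0 : 0 < al) k f i x : smooth_on setT f ->
  is_derive x (dir i) (flat al k \o f)
    ((al * flat al k.+2 (f x) - k%:R * flat al k.+1 (f x)) * partial i f x).
Proof.
move=> sf; apply: is_derive_comp1; first exact: is_derive_flat.
exact: smooth_is_derive.
Qed.

Lemma smooth_flat al k f : 0 < al -> smooth_on setT f ->
  smooth_on setT (flat al k \o f).
Proof.
move=> al0 sf.
pose A := [set g | smooth_on setT g \/ exists j, g = flat al j \o f].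
apply: (generated_smooth (A := A)); last first.
  by apply: generated_base; right; exists k.
move=> g [sg|[j ->]].
  split=> [|i]; first exact: smooth_continuous.
  exists (partial i g); last by move=> x; exact: smooth_is_derive.
  by apply: generated_base; left; exact: smooth_partial.
split=> [x|i].
  apply: continuous_comp; first exact: smooth_continuous.
  exact: continuous_flat.
exists (((cst al \* (flat al j.+2 \o f)) \+
   (cst (- j%:R) \* (flat al j.+1 \o f))) \* partial i f).
  apply: generated_mul; last first.
    by apply: generated_base; left; exact: smooth_partial.
  by apply: generated_add; apply: generated_mul; [exact: generated_cst|
    apply: generated_base; right; eexists|exact: generated_cst|
    apply: generated_base; right; eexists].
move=> x /=; rewrite mulNr; exact: is_derive_flat_comp.
Qed.

Lemma is_derive_sqrt_comp f i x : smooth_on setT f -> 0 < f x ->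
  is_derive x (dir i) (Num.sqrt \o f)
    (partial i f x / (2 * Num.sqrt (f x))).
Proof.
move=> sf f0; rewrite mulrC; apply: is_derive_comp1.
  exact: is_derive1_sqrt.
exact: smooth_is_derive.
Qed.

Lemma smooth_sqrt f : smooth_on setT f -> (forall x, 0 < f x) ->
  smooth_on setT (Num.sqrt \o f).
Proof.
move=> sf f0; pose q := Num.sqrt \o f; pose q' x := (q x)^-1.
have q0 x : 0 < q x by rewrite sqrtr_gt0.
have cq : continuous q.
  move=> x; apply: continuous_comp; first exact: smooth_continuous.
  exact: sqrt_continuous.
have dq i x : is_derive x (dir i) q (2^-1 * (partial i f x * q' x)).
  apply: is_derive_eq; first exact: is_derive_sqrt_comp.
  by rewrite invfM mulrCA.
pose A := [set g | [\/ smooth_on setT g, g = q | g = q']].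
apply: (generated_smooth (A := A)); last by apply: generated_base; constructor 2.
have gq i : generated A (partial i f \* q').
  apply: generated_mul; apply: generated_base; last by constructor 3.
  by constructor 1; exact: smooth_partial.
move=> g [sg|->|->].
- split=> [|i]; first exact: smooth_continuous.
  exists (partial i g); last by move=> x; exact: smooth_is_derive.
  by apply: generated_base; constructor 1; exact: smooth_partial.
- split=> // i; exists (cst 2^-1 \* (partial i f \* q')) => //.
  by apply: generated_mul; [exact: generated_cst|].
- split=> [x|i]; first by apply: continuousV; [rewrite gt_eqF|exact: cq].
  exists ((cst (- 1)) \* ((q' \* q') \* (cst 2^-1 \* (partial i f \* q')))).
    have gq' : generated A q' by apply: generated_base; constructor 3.
    by repeat (apply: generated_mul => //); exact: generated_cst.
  move=> x /=; have [h1 h2] := dq i x.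
  apply: DeriveDef; first by apply: derivableV; [rewrite gt_eqF|].
  rewrite deriveV ?gt_eqF// h2 /GRing.scale /= !mulNr mul1r.
  by rewrite -exprVn expr2.
Qed.

End smooth_composites.

(** * Translation invariance of the Lebesgue measure *)
Section lebesgue_rV_translation.
Context {R : realType}.
Local Notation leb := (@lebesgue_measure R).

Lemma lebesgue_measure_translate (h : R) (A : set R) : measurable A ->
  leb ((fun x : R => x + h) @^-1` A) = leb A.
Proof.
move=> mA.
have mh : measurable_fun [set: measurableTypeR R]
    ((fun x : R => x + h) : measurableTypeR R -> measurableTypeR R).
  exact: measurable_funD.
pose m := measure_function_pushforward__canonical__measure_function_Measure
  leb mh.
apply/esym; apply: (@lebesgue_measure_unique R m) => // _ [[a b]] _ <-.
rewrite /m /= /pushforward.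
have -> : (fun x : R => x + h) @^-1` `]a, b] = `]a - h, b - h]%classic.
  by apply/seteqP; split=> x /=; rewrite !in_itv /= ltrBlDr lerBrDr.
rewrite !lebesgue_measure_itv/= !lte_fin ltrD2r.
by case: ifP => // _; rewrite -!EFinD; congr (_%:E); ring.
Qed.

Lemma measurable_translate n (h : 'rV[R]_n) :
  measurable_fun setT (fun x : 'rV[R]_n => x + h).
Proof.
apply: measurable_fun_rV => i; under eq_fun do rewrite mxE.
by apply: measurable_funD => //; exact: measurable_coord.
Qed.

(** Induction on the dimension: the first coordinate is translated in the
    outer integral, the others in the sections. *)
Lemma lebesgue_rV_translate n (h : 'rV[R]_n) (A : set 'rV[R]_n) :
  measurable A -> lebesgue_rV n ((fun x => x + h) @^-1` A) = lebesgue_rV n A.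
Proof.
elim: n h A => [|n IH] h A mA.
  rewrite (_ : _ @^-1` A = A)//; apply/seteqP.
  by split=> x /=; rewrite [x + h](_ : _ = x)//; apply/rowP => -[].
rewrite /= /lebesgue_rV_step /pushforward /product_measure1.
set B := @rV_cons R n @^-1` A.
have mB : measurable B.
  by rewrite -[B]setTI; exact: (@measurable_rV_cons R n measurableT A mA).
pose F x := lebesgue_rV n (xsection B x).
have mF : measurable_fun setT F by exact: measurable_fun_xsection.
have mh : measurable_fun [set: measurableTypeR R]
    ((fun x : R => x + h ord0 ord0) : measurableTypeR R -> measurableTypeR R).
  exact: measurable_funD.
transitivity (\int[leb]_x F ((x : R) + h ord0 ord0)%R)%E.
  apply: eq_integral => x _ /=.
  rewrite -[RHS](IH (\row_j h ord0 (lift ord0 j))); last exact: measurable_xsection.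
  congr (lebesgue_rV n _); apply/seteqP.
  have e y : rV_cons (x, y) + h =
      rV_cons (x + h ord0 ord0, y + \row_j h ord0 (lift ord0 j)).
    apply/rowP => i; rewrite mxE !rV_consE /=.
    by case: unliftP => [j ->|->] //; rewrite !mxE.
  by split=> y; rewrite /xsection /= !inE /B /= e.
pose m := measure_function_pushforward__canonical__measure_function_Measure
  leb mh.
have <- : (\int[m]_x F x = \int[leb]_x F x)%E.
  by apply: eq_measure_integral => C mC _; exact: lebesgue_measure_translate.
by rewrite ge0_integral_pushforward.
Qed.

Lemma ge0_integral_translate n (h : 'rV[R]_n) (f : 'rV[R]_n -> \bar R) :
  measurable_fun setT f -> (forall x, 0 <= f x)%E ->
  (\int[lebesgue_rV n]_x f (x + h)%R = \int[lebesgue_rV n]_x f x)%E.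
Proof.
move=> mf f0; have mh := measurable_translate h.
pose m := measure_function_pushforward__canonical__measure_function_Measure
  (lebesgue_rV n) mh.
have <- : (\int[m]_x f x = \int[lebesgue_rV n]_x f x)%E.
  by apply: eq_measure_integral => C mC _; exact: lebesgue_rV_translate.
by rewrite ge0_integral_pushforward.
Qed.

Lemma integral_translate n (h : 'rV[R]_n) (f : 'rV[R]_n -> \bar R) :
  measurable_fun setT f ->
  (\int[lebesgue_rV n]_x f (x + h)%R = \int[lebesgue_rV n]_x f x)%E.
Proof.
move=> mf; rewrite integralE [RHS]integralE.
have hp := ge0_integral_translate h (measurable_funepos mf)
  (fun x => funepos_ge0 f x).
have hn := ge0_integral_translate h (measurable_funeneg mf)
  (fun x => funeneg_ge0 f x).
rewrite -hp -hn.
by congr (_ - _)%E; apply: eq_integral => x _; rewrite !(funeposE, funenegE).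
Qed.

End lebesgue_rV_translation.

(** * Continuous functions with bounded support *)
Section compactly_supported.
Context {R : realType} {n : nat}.
Local Notation V := 'rV[R]_n.
Local Notation mu := (@lebesgue_rV R n).
Local Notation leb := (@lebesgue_measure R).
Implicit Types (f g : V -> R).

Lemma continuous_measurable_rV f : continuous f -> measurable_fun setT f.
Proof.
move=> cf; apply: (measurability _ (RGenOpens.measurableE R)).
move=> _ [_ [x [y ->]] <-]; rewrite setTI; apply: open_measurable_rV.
by move/continuousP : cf; apply; exact: interval_open.
Qed.

Lemma coord_le_norm (x : V) i : `|x ord0 i| <= `|x|.
Proof.
rewrite [leRHS]/Num.norm /= mx_normrE.
exact: (le_bigmax _ (fun ij => `|x ij.1 ij.2|) (ord0, i)).
Qed.

Lemma closed_norm_ball (r : R) : closed [set x : V | `|x| <= r].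
Proof.
have -> : [set x : V | `|x| <= r] =
  (fun x : V => `|x|) @^-1` [set y : R | y <= r] by [].
by apply: closed_comp; [move=> x _; exact: norm_continuous|exact: closed_le].
Qed.

Lemma measurable_norm_ball (r : R) : measurable [set x : V | `|x| <= r].
Proof.
rewrite -[X in measurable X]setCK; apply: measurableC.
by apply: open_measurable_rV; apply: closed_openC; exact: (@closed_norm_ball r).
Qed.

Lemma lebesgue_rV_norm_ball (r : R) : (mu [set x : V | `|x|%R <= r]%R < +oo)%E.
Proof.
apply: (@le_lt_trans _ _
  (mu [set x : V | forall i, `[(- r)%R, r]%classic (x ord0 i)])).
  apply: le_measure; rewrite ?inE; [exact: measurable_norm_ball| |].
    exact: (@measurable_box R n (fun=> `[(- r)%R, r]%classic)).
  move=> x /= xr i; rewrite in_itv /= -ler_norml.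
  by rewrite (le_trans (coord_le_norm x i)).
rewrite (@lebesgue_rV_box R n (fun=> `[(- r)%R, r]%classic))//.
suff : (\prod_(i < n) leb (`[(- r)%R, r] : set (measurableTypeR R)))%E
  \is a fin_num.
  by rewrite ltey_eq => ->.
elim/big_ind : _ => // [x y|i _]; first exact: fin_numM.
by rewrite lebesgue_measure_itv; case: ifP.
Qed.

Definition vanishes_far f := exists r : R, forall x, r < `|x| -> f x = 0.

Lemma bounded_supp f : continuous f -> vanishes_far f ->
  exists2 C, 0 <= C & forall x, `|f x| <= C.
Proof.
move=> cf [r fr].
have cB : compact [set x : V | `|x| <= r].
  apply: bounded_closed_compact; last exact: (@closed_norm_ball r).
  exists r; split; first exact: num_real.
  by move=> M rM x /= /le_trans; apply; exact: ltW.
have := compact_bounded (continuous_compact (continuous_subspaceT cf) cB).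
move=> [M [_ HM]]; exists (`|M| + 1) => [|x]; first by rewrite addr_ge0.
have [xr|/fr ->] := leP `|x| r; last by rewrite normr0 addr_ge0.
apply: (HM (`|M| + 1)); first by rewrite (le_lt_trans (ler_norm _)) ?ltrDl.
by exists x.
Qed.

Lemma dominated_integrable f (C r : R) : measurable_fun setT f ->
  (forall x, `|f x| <= C) -> (forall x, r < `|x| -> f x = 0) ->
  mu.-integrable setT (EFin \o f).
Proof.
move=> mf fC fr.
set B := [set x : V | `|x| <= r].
have mB : measurable B by exact: measurable_norm_ball.
have iB : mu.-integrable B (EFin \o f).
  apply: measurable_bounded_integrable => //; first exact: lebesgue_rV_norm_ball.
    exact: measurable_funTS.
  exists C; split; first exact: num_real.
  by move=> M CM x _ /=; rewrite (le_trans (fC x))// ltW.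
have := (integrable_mkcond (EFin \o f) mB).1 iB.
congr (integrable _ _ _); apply/funext => x; rewrite patchE.
case: ifPn => //; rewrite notin_setE /B /= => /negP.
by rewrite -ltNge => /fr ->.
Qed.

Lemma integrable_supp f : continuous f -> vanishes_far f ->
  mu.-integrable setT (EFin \o f).
Proof.
move=> cf vf; have [C _ fC] := bounded_supp cf vf; have [r fr] := vf.
by apply: (dominated_integrable _ fC fr); exact: continuous_measurable_rV.
Qed.

End compactly_supported.

(** * The integral of a partial derivative *)
Section integration_by_parts.
Context {R : realType} {n : nat}.
Local Notation V := 'rV[R]_n.
Local Notation mu := (@lebesgue_rV R n).
Local Notation dir i := (delta_mx ord0 i : 'rV[R]_n).
Implicit Types (f g : V -> R).

Lemma vanishes_farD f g : vanishes_far f -> vanishes_far g ->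
  vanishes_far (f \+ g).
Proof.
move=> [r fr] [s gs]; exists (Num.max r s) => x.
by rewrite gt_max => /andP[/fr fx /gs gx]; rewrite /= fx gx addr0.
Qed.

Lemma vanishes_farMl f g : vanishes_far f -> vanishes_far (f \* g).
Proof. by move=> [r fr]; exists r => x /fr /= ->; rewrite mul0r. Qed.

Lemma vanishes_farMr f g : vanishes_far g -> vanishes_far (f \* g).
Proof. by move=> [r fr]; exists r => x /fr /= ->; rewrite mulr0. Qed.

Lemma vanishes_far_sum (I : Type) (r : seq I) (F : I -> V -> R) :
  (forall i, vanishes_far (F i)) -> vanishes_far (fun x => \sum_(i <- r) F i x).
Proof.
move=> vF; elim: r => [|i r IH].
  by exists 0 => x _; rewrite big_nil.
by under eq_fun do rewrite big_cons; exact: vanishes_farD.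
Qed.

Lemma vanishes_far_translate f (h : V) : vanishes_far f ->
  vanishes_far (fun x => f (x + h)).
Proof.
move=> [r fr]; exists (r + `|h|) => x xr; apply: fr.
rewrite -ltrBrDr in xr; apply: (lt_le_trans xr).
by rewrite lerBlDr -{1}(addrK h x) ler_normB.
Qed.

Lemma vanishes_far_partial f i : vanishes_far f -> vanishes_far (partial i f).
Proof.
move=> [r fr]; exists r => x xr; rewrite /partial.
rewrite (@near_eq_derive _ _ _ _ (cst 0)) ?derive_cst//.
have cn : {for x, continuous (fun y : V => `|y|)} by exact: norm_continuous.
near=> y; rewrite /= fr//; near: y.
by apply: (cvgr_gt _ cn); exact: xr.
Unshelve. all: by end_near. Qed.

Lemma is_derive_line_at f (x v : V) (s d : R) :
  is_derive (s *: v + x) v f d ->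
  is_derive s (1 : R) (fun t : R => f (t *: v + x)) d.
Proof.
have e : (fun h : R =>
     h^-1 *: ((f \o shift (s *: v + x)) (h *: v) - f (s *: v + x)))
   = (fun h : R => h^-1 *: (((fun t : R => f (t *: v + x)) \o shift s) (h *: 1) -
      f (s *: v + x))).
  by apply/funext => h /=; rewrite [h *: 1]mulr1 scalerDl addrA.
by move=> [h1 h2]; split; [rewrite /derivable -e|rewrite /derive -e].
Qed.

Lemma increment_le f i (C : R) (x : V) (t : R) : smooth_on setT f -> 0 <= t ->
  (forall y, `|partial i f y| <= C) -> `|f (t *: dir i + x) - f x| <= C * t.
Proof.
move=> sf t0 dC.
have D s : is_derive s (1 : R) (fun t : R => f (t *: dir i + x))
    (partial i f (s *: dir i + x)).
  exact/is_derive_line_at/smooth_is_derive.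
have [|c _] := MVT_segment t0 (fun s _ => D s).
  apply: continuous_subspaceT => s.
  by apply/differentiable_continuous/derivable1_diffP; case: (D s).
rewrite /= scale0r add0r subr0 => ->.
by rewrite normrM (ger0_norm t0) ler_wpM2r.
Qed.

Lemma norm_dir i : `|dir i| <= 1 :> R.
Proof.
rewrite [leLHS]/Num.norm /= mx_normrE; apply/bigmax_leP; split=> //= -[j k] _ /=.
by rewrite mxE; case: (_ && _); rewrite ?normr1 ?normr0.
Qed.

(** The difference quotients have integral 0 by translation invariance; they
    are bounded by the maximum of the derivative, and for increments at most 1
    their supports stay in one ball, so the limit passes under the integral. *)
Lemma integral_partial f i : smooth_on setT f -> vanishes_far f ->
  (\int[mu]_x (partial i f x)%:E = 0)%E.
Proof.
move=> sf vf; have [r fr] := vf; have cf := smooth_continuous sf.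
have sd := smooth_partial i sf.
have mf := continuous_measurable_rV cf.
have [C C0 dC] := bounded_supp (smooth_continuous sd) (vanishes_far_partial i vf).
pose t k : R := k.+1%:R^-1.
have t0 k : 0 < t k by rewrite invr_gt0.
have t1 k : t k <= 1 by rewrite invf_le1// ler1n.
pose g k x := (t k)^-1 * (f (t k *: dir i + x) - f x).
pose B := [set x : V | `|x| <= r + 1].
have mB : measurable B by exact: measurable_norm_ball.
pose G x : R := C * \1_B x.
have mft k : measurable_fun setT (fun x => f (t k *: dir i + x)).
  under eq_fun do rewrite addrC.
  by apply: (measurableT_comp mf); exact: measurable_translate.
have mg k : measurable_fun setT (g k).
  by apply: measurable_funM => //; apply: measurable_funB.
have iG : mu.-integrable setT (EFin \o G).
  apply: (@dominated_integrable _ _ _ C (r + 1)).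
  - by apply: measurable_funM => //; exact: measurable_indic.
  - move=> x; rewrite normrM (ger0_norm C0) ler_piMr// indicE.
    by case: (_ \in _); rewrite ?normr1 ?normr0.
  - by move=> x xr; rewrite /G indicE memNset ?mulr0// /B /= leNgt xr.
have gG k x : `|g k x| <= G x.
  rewrite /g /G indicE; have [xB|] := boolP (x \in B).
    rewrite mulr1 normrM ger0_norm ?invr_ge0 ?(ltW (t0 k))//.
    by rewrite ler_pdivrMl// mulrC increment_le// ltW.
  rewrite notin_setE /B /= => /negP; rewrite -ltNge => xr.
  have ex : `|t k *: dir i| <= 1.
    rewrite normrZ ger0_norm ?(ltW (t0 k))//.
    by rewrite -[leRHS]mulr1 ler_pM// ?norm_dir// ltW.
  rewrite !fr ?subrr ?mulr0 ?normr0 ?mulr_ge0//.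
    by rewrite (le_lt_trans _ xr)// lerDl.
  rewrite -ltrBrDr in xr; apply: (lt_le_trans xr).
  rewrite lerBlDr -{1}(addrK (t k *: dir i) x) (le_trans (ler_normB _ _))//.
  by rewrite [x + _]addrC lerD2l.
have tcvg : t @ \oo --> (0 : R)^'.
  move=> A HA.
  have : nbhs (0 : R) [set y : R | y != 0 -> A y] by exact: HA.
  move=> /cvg_harmonic H.
  have {}H : \forall k \near \oo, (t k != 0 -> A (t k)) by exact: H.
  by apply: filterS H => k; apply; rewrite gt_eqF//; exact: t0.
have gcvg x : g ^~ x @ \oo --> partial i f x.
  have [h1 h2] := smooth_is_derive i x sf.
  rewrite -h2; exact: (cvg_comp _ _ tcvg h1).
have egcvg x : (g k x)%:E @[k --> \oo] --> (partial i f x)%:E.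
  by apply/fine_cvgP; split; [exact: nearW|exact: gcvg].
have mEg k : measurable_fun setT (fun x => (g k x)%:E) by exact/measurable_EFinP.
have mEd : measurable_fun setT (fun x => (partial i f x)%:E).
  apply/measurable_EFinP; apply: continuous_measurable_rV.
  exact: smooth_continuous.
have ae1 : {ae mu, forall x, setT x ->
    (g k x)%:E @[k --> \oo] --> (partial i f x)%:E}.
  by apply: aeW => x _; exact: egcvg.
have ae2 : {ae mu, forall x k, setT x -> (`|(g k x)%:E| <= (EFin \o G) x)%E}.
  by apply: aeW => x k _; rewrite /= lee_fin.
have [_ _] := dominated_convergence measurableT mEg mEd ae1 iG ae2.
rewrite (_ : [sequence _]_n = cst 0%E); last first.
  apply/funext => k /=.
  have if1 : mu.-integrable setT (fun x => (f (t k *: dir i + x))%:E).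
    under eq_fun do rewrite addrC.
    apply: (integrable_supp (f := fun x => f (x + t k *: dir i))).
      exact/smooth_continuous/smooth_translate.
    exact: vanishes_far_translate.
  have if2 : mu.-integrable setT (fun x => (f x)%:E) by exact: integrable_supp.
  under eq_integral do rewrite EFinM EFinB.
  rewrite integralZl//; last exact: integrableB.
  rewrite integralB//; under eq_integral do rewrite addrC.
  rewrite (integral_translate _ (f := EFin \o f)); last exact/measurable_EFinP.
  by rewrite subee ?mule0//; exact: integrable_fin_num.
by move=> H; apply: (cvg_unique _ H (cvg_cst _)).
Qed.

End integration_by_parts.

(** * The fundamental lemma of the calculus of variations *)
Section vanishing_integrals.
Context d (T : measurableType d) (R : realType).
Variable mu : {measure set T -> \bar R}.

(** The sets over which the integral of [g] vanishes form a Dynkin system, so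
    they are all the measurable sets. *)
Lemma ae_eq0_pi_system (G : set (set T)) (g : T -> \bar R) :
  @measurable _ T = <<s G >> -> setI_closed G ->
  mu.-integrable setT g -> (\int[mu]_x g x = 0)%E ->
  (forall B, G B -> \int[mu]_(x in B) g x = 0)%E ->
  ae_eq mu setT g (cst 0%E).
Proof.
move=> mG GI ig g0 G0.
have ig' A : measurable A -> mu.-integrable A g.
  by move=> mA; apply: integrableS ig.
have H A : measurable A -> (\int[mu]_(x in A) g x = 0)%E.
  move=> mA; have : <<s G >> A by rewrite -mG.
  apply: (@dynkin_induction _ _ G (fun A => \int[mu]_(x in A) g x = 0)%E) => //.
  - move=> S mS gS.
    have := @integral_setU _ _ _ mu S (~` S) g mS (measurableC mS).
    rewrite setUv g0 gS add0e => ->//; first exact: measurable_int ig.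
    by apply/disj_setPCl.
  - move=> F mF tF F0; rewrite integral_bigcup//; last first.
      by apply: ig'; exact: bigcupT_measurable.
    by rewrite eseries0.
apply: integral_ae_eq => // E _ mE.
by rewrite H// integral0.
Qed.

(** On a set of finite measure square integrability gives integrability, by
    [|f| <= 1 + f^2]. *)
Lemma sqr_integrable (M A : set T) (f : T -> R) :
  measurable M -> measurable A -> A `<=` M -> (mu A < +oo)%E ->
  measurable_fun M f -> (\int[mu]_(x in M) (f x ^+ 2)%:E < +oo)%E ->
  mu.-integrable A (EFin \o f).
Proof.
move=> mM mA AM muA mf f2.
have i2 : mu.-integrable A (fun x => (f x ^+ 2)%:E).
  apply: (@integrableS _ _ _ _ M) => //; apply/integrableP; split.
    by apply/measurable_EFinP; exact: measurable_funX.
  under eq_integral => x _ do rewrite gee0_abs ?lee_fin ?sqr_ge0//.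
  exact: f2.
have i1 : mu.-integrable A (cst 1%E).
    apply: (@measurable_bounded_integrable _ _ _ mu (cst 1) A) => //.
    exists 1; split; [exact: num_real|move=> C C1 x _ /=].
    by rewrite normr1 ltW.
apply: le_integrable (integrableD mA i2 i1) => //.
  by apply/measurable_EFinP; exact: measurable_funS mf.
move=> x Ax /=; rewrite lee_fin [leRHS]ger0_norm ?addr_ge0 ?sqr_ge0//.
have := sqr_ge0 (`|f x| - 1 / 2); rewrite sqrrB real_normK ?num_real//.
by rewrite expr_div_n; lra.
Qed.

End vanishing_integrals.

Section boxes.
Context {R : realType} {n : nat}.
Local Notation V := 'rV[R]_n.
Local Notation mu := (@lebesgue_rV R n).
Implicit Types (f g : V -> R) (a b : 'I_n -> R).

Definition obox a b := [set x : V | forall i, `]a i, b i[%classic (x ord0 i)].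
Definition cbox a b := [set x : V | forall i, `[a i, b i]%classic (x ord0 i)].

Lemma measurable_obox a b : measurable (obox a b).
Proof. by apply: (@measurable_box R n (fun i => `]a i, b i[%classic)). Qed.

Lemma measurable_cbox a b : measurable (cbox a b).
Proof. by apply: (@measurable_box R n (fun i => `[a i, b i]%classic)). Qed.

Lemma compact_cbox a b : compact (cbox a b).
Proof.
apply: (@rV_compact _ _ (fun i => `[a i, b i]%classic)) => i.
exact: segment_compact.
Qed.

Lemma obox_cbox a b : obox a b `<=` cbox a b.
Proof. by move=> x xab i; apply: subset_itv_oo_cc; exact: xab. Qed.

Lemma cbox_finite a b : (mu (cbox a b) < +oo)%E.
Proof.
rewrite (@lebesgue_rV_box R n (fun i => `[a i, b i]%classic))//.
suff : (\prod_(i < n) (@lebesgue_measure R)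
  (`[a i, b i] : set (measurableTypeR R)))%E \is a fin_num.
  by rewrite ltey_eq => ->.
elim/big_ind : _ => // [x y|i _]; first exact: fin_numM.
by rewrite lebesgue_measure_itv; case: ifP.
Qed.

Definition oboxes : set (set V) := [set B | exists a b, B = obox a b].

Lemma obox_setI a b a' b' : obox a b `&` obox a' b' =
  obox (fun i => Num.max (a i) (a' i)) (fun i => Num.min (b i) (b' i)).
Proof.
apply/seteqP; split=> x /=.
  move=> [xab xab'] i; have := xab i; have := xab' i.
  by rewrite /= !in_itv /= gt_max lt_min => /andP[-> ->] /andP[-> ->].
by move=> H; split=> i; have := H i;
  rewrite /= !in_itv /= gt_max lt_min => /andP[/andP[? ?] /andP[? ?]]; apply/andP.
Qed.

Lemma oboxes_setI_closed : setI_closed oboxes.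
Proof.
by move=> _ _ [a [b ->]] [a' [b' ->]]; rewrite obox_setI; do 2 eexists.
Qed.

(** A preimage of an open interval under a coordinate is the union over [k] of
    the boxes whose other sides are the intervals from [-k] to [k]. *)
Lemma measurable_oboxes : @measurable _ V = <<s oboxes >>.
Proof.
apply/seteqP; split; last first.
  apply: smallest_sub; first exact: sigma_algebra_measurable.
  by move=> _ [a [b ->]]; exact: measurable_obox.
apply: smallest_sub; first exact: smallest_sigma_algebra.
rewrite -bigcup_seq => B [i _ [Y mY <-]] /=; rewrite setTI.
pose S := [set Z : set R | <<s oboxes >> ((fun x : V => x ord0 i) @^-1` Z)].
suff : @measurable _ (measurableTypeR R) `<=` S by apply.
have -> : @measurable _ (measurableTypeR R) = <<s @RGenOpens.G R >>.
  exact: RGenOpens.measurableE.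
apply: smallest_sub.
  split => [|Z|F]; rewrite /S/=.
  - by rewrite preimage_set0; exact: sigma_algebra0.
  - by move=> mZ; rewrite setTD preimage_setC; exact: sigma_algebraC.
  - by move=> mF; rewrite preimage_bigcup; exact: sigma_algebra_bigcup.
move=> _ [x [y ->]]; rewrite /S /=.
rewrite (_ : _ @^-1` _ = \bigcup_k
   obox (fun j => if j == i then x else - k%:R)
        (fun j => if j == i then y else k%:R)).
  apply: sigma_algebra_bigcup => k; apply: sub_sigma_algebra.
  by do 2 eexists.
apply/seteqP; split=> [v /= vxy|v [k _ /(_ i)]] /=; last by rewrite eqxx.
exists (Num.truncn `|v|).+1 => // j /=; case: eqP => [->//|_].
rewrite in_itv /= -ltr_norml (le_lt_trans (coord_le_norm v j))//.
exact: truncnS_gt.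
Qed.

(** A product of factors [exp (- t / s)], which is smooth, vanishes exactly off
    the open box and increases to its indicator function as [t] tends to 0. *)
Definition box_bump (t : R) a b : V -> R := fun x =>
  \prod_(i < n) (flat t 0 (x ord0 i - a i) * flat t 0 (b i - x ord0 i)).

Lemma box_bump_smooth t a b : 0 < t -> smooth_on setT (box_bump t a b).
Proof.
move=> t0; apply: smooth_prod => i.
apply: (@smoothM _ _ (fun x => flat t 0 (x ord0 i - a i))
                     (fun x => flat t 0 (b i - x ord0 i))).
  apply: (@smooth_flat _ _ _ _ (fun x => x ord0 i - a i)) => //.
  apply: (@smoothD _ _ (fun x => x ord0 i) (cst (- a i))).
    exact: smooth_coord.
  exact: smooth_cst.
apply: (@smooth_flat _ _ _ _ (fun x => b i - x ord0 i)) => //.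
apply: (@smoothD _ _ (cst (b i)) (fun x => - x ord0 i)); first exact: smooth_cst.
by under eq_fun do rewrite -mulN1r; apply: smoothZ; exact: smooth_coord.
Qed.

Lemma box_bump_out t a b x : ~ obox a b x -> box_bump t a b x = 0.
Proof.
move=> /existsNP[i /= /negP]; rewrite in_itv /= negb_and -!leNgt => xi.
rewrite /box_bump (bigD1 i)//=.
case/orP: xi => xi.
  by rewrite [flat _ _ (x ord0 i - _)]flat_eq0 ?subr_le0// !mul0r.
by rewrite [flat _ _ (b i - _)]flat_eq0 ?subr_le0// mulr0 mul0r.
Qed.

Lemma box_bump_in t a b x : obox a b x -> box_bump t a b x =
  expR (- t * \sum_(i < n) ((x ord0 i - a i)^-1 + (b i - x ord0 i)^-1)).
Proof.
move=> xab; rewrite mulr_sumr expR_sum; apply: eq_bigr => i _.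
have := xab i; rewrite /= in_itv /= => /andP[ax xb].
by rewrite /flat !subr_gt0 ax xb !expr0 !mul1r -expRD mulrDr !mulNr.
Qed.

Lemma box_bump_cvg a b x : obox a b x ->
  box_bump k.+1%:R^-1 a b x @[k --> \oo] --> (1 : R).
Proof.
move=> xab; under eq_fun do rewrite box_bump_in//.
set c := \sum_(i < n) _.
have H : (fun k : nat => - k.+1%:R^-1 * c) @ \oo --> (0 : R).
  rewrite -(mul0r c) -oppr0.
  by apply: cvgMl; apply: cvgN; exact: cvg_harmonic.
by have := cvg_comp _ _ H (@continuous_expR R 0); rewrite expR0.
Qed.

Lemma box_bump_le1 t a b x : 0 < t -> 0 <= box_bump t a b x <= 1.
Proof.
move=> t0; have [xab|xab] := pselect (obox a b x); last first.
  by rewrite box_bump_out// lexx ler01.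
rewrite box_bump_in// expR_ge0 /= expR_le1 mulNr oppr_le0 mulr_ge0 ?(ltW t0)//.
apply: sumr_ge0 => i _; have := xab i; rewrite /= in_itv /= => /andP[ax xb].
by rewrite addr_ge0// invr_ge0 subr_ge0 ltW.
Qed.

End boxes.

Definition real_test {R : realType} {n : nat} (M : set 'rV[R]_n)
    (phi : 'rV[R]_n -> R) :=
  smooth_on setT phi /\
  exists C, [/\ compact C, C `<=` M & forall x, ~ C x -> phi x = 0].

Section fundamental_lemma.
Context {R : realType} {n : nat}.
Local Notation V := 'rV[R]_n.
Local Notation mu := (@lebesgue_rV R n).
Variables (M : set V) (f : V -> R).
Hypothesis oM : open M.
Hypothesis mf : measurable_fun M f.
Hypothesis f2 : (\int[mu]_(x in M) (f x ^+ 2)%:E < +oo)%E.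
Hypothesis f_test : forall phi, real_test M phi ->
  \int[mu]_(x in M) (f x * phi x) = 0.

Let mM : measurable M := open_measurable_rV oM.

Lemma integrable_cbox a b : cbox a b `<=` M ->
  mu.-integrable (cbox a b) (EFin \o f).
Proof.
move=> abM; apply: (@sqr_integrable _ _ _ mu M) => //; last exact: cbox_finite.
exact: measurable_cbox.
Qed.

(** The box bumps tend to the indicator function of the open box and are
    dominated by that of the closed one, on which [f] is integrable. *)
Lemma integral_obox0 a b : cbox a b `<=` M ->
  (\int[mu]_(x in obox a b) (f x)%:E = 0)%E.
Proof.
move=> abM; pose phi k := box_bump k.+1%:R^-1 a b.
have k0 k : 0 < k.+1%:R^-1 :> R by rewrite invr_gt0.
have mQ := measurable_cbox a b.
have mfQ : measurable_fun (cbox a b) f by exact: measurable_funS mf.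
have sphi k : smooth_on setT (phi k) by exact: box_bump_smooth.
have mphi k : measurable_fun setT (phi k).
  by apply: continuous_measurable_rV; exact: smooth_continuous.
have iQ := integrable_cbox abM.
have mfphi k : measurable_fun (cbox a b) (fun x => (f x * phi k x)%:E).
  by apply/measurable_EFinP; apply: measurable_funM => //; exact: measurable_funTS.
have ifphi k : mu.-integrable (cbox a b) (fun x => (f x * phi k x)%:E).
  apply: le_integrable iQ => // x _ /=; rewrite lee_fin normrM ler_piMr//.
  by have /andP[h0 h1] := box_bump_le1 a b x (k0 k); rewrite ger0_norm.
have I0 k : (\int[mu]_(x in cbox a b) (f x * phi k x)%:E = 0)%E.
  have e : (\int[mu]_(x in M) (f x * phi k x)%:E =
      \int[mu]_(x in cbox a b) (f x * phi k x)%:E)%E.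
    rewrite integral_mkcond [RHS]integral_mkcond; apply: eq_integral => x _.
    rewrite !patchE; have [xQ|xQ] := boolP (x \in cbox a b).
      by rewrite mem_set//; apply: abM; rewrite inE in xQ.
    case: ifP => // _; rewrite /phi box_bump_out ?mulr0// => /obox_cbox.
    by rewrite notin_setE in xQ.
  have := f_test (phi := phi k); rewrite /Rintegral e => h.
  rewrite -[LHS]fineK ?h//; last exact: integrable_fin_num.
  split => //; exists (cbox a b); split=> //; first exact: compact_cbox.
  by move=> x xQ; rewrite /phi box_bump_out// => /obox_cbox.
have mlim : measurable_fun (cbox a b) (fun x => (f x * \1_(obox a b) x)%:E).
  apply/measurable_EFinP; apply: measurable_funM => //.
  by apply: measurable_indic; exact: measurable_obox.
have ae1 : {ae mu, forall x, cbox a b x ->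
    (f x * phi k x)%:E @[k --> \oo] --> (f x * \1_(obox a b) x)%:E}.
  apply: aeW => x _; apply/fine_cvgP; split; first exact: nearW.
  apply: cvgMr; rewrite indicE; have [xQ|xQ] := boolP (x \in obox a b).
    by apply: box_bump_cvg; rewrite inE in xQ.
  rewrite (_ : (fun k => phi k x) = cst 0); first exact: cvg_cst.
  by apply/funext => k; rewrite /phi box_bump_out//; rewrite notin_setE in xQ.
have ae2 : {ae mu, forall x k, cbox a b x ->
    (`|(f x * phi k x)%:E| <= `|(EFin \o f) x|)%E}.
  apply: aeW => x k _; rewrite /= lee_fin normrM ler_piMr//.
  by have /andP[h0 h1] := box_bump_le1 a b x (k0 k); rewrite ger0_norm.
have [_ _] := dominated_convergence mQ mfphi mlim ae1 (integrable_abse iQ) ae2.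
rewrite (_ : [sequence _]_k = cst 0%E); last exact/funext.
move=> /(cvg_unique _ (cvg_cst _)) => e0.
rewrite [RHS]e0 // [LHS]integral_mkcond [RHS]integral_mkcond.
apply: eq_integral => x _; rewrite !patchE indicE.
have [xo|xo] := boolP (x \in obox a b); last by rewrite mulr0 if_same.
by rewrite mem_set ?mulr1//; apply: obox_cbox; rewrite inE in xo.
Qed.

Lemma ae_eq0_obox a b : cbox a b `<=` M ->
  {ae mu, forall x, obox a b x -> f x = 0}.
Proof.
move=> abM; pose Q := obox a b; have mQ : measurable Q := measurable_obox a b.
have iQ : mu.-integrable Q (EFin \o f).
  apply: integrableS (integrable_cbox abM) => //; last exact: obox_cbox.
  exact: measurable_cbox.
have := @ae_eq0_pi_system _ _ _ mu oboxes ((EFin \o f) \_ Q)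
  measurable_oboxes oboxes_setI_closed ((integrable_mkcond _ mQ).1 iQ).
move=> /(_ _ _)/wrap[||].
- by rewrite -integral_mkcond; exact: integral_obox0.
- move=> _ [a' [b' ->]]; rewrite -integral_mkcondr obox_setI.
  apply: integral_obox0; apply: subset_trans abM => x H i.
  have := H i; rewrite /= !in_itv /= ge_max le_min.
  by move=> /andP[/andP[_ ->] /andP[_ ->]].
- apply: filterS => x /(_ I) + Qx; rewrite patchE mem_set//.
  by move=> [].
Qed.

(** An open set is covered by countably many open boxes whose closures it
    contains: those with rational centres and sides [2 / k.+1]. *)
Lemma ae_eq0_test : {ae mu, forall x, M x -> f x = 0}.
Proof.
pose c (i : 'rV[rat]_n * nat) : V := map_mx ratr i.1.
pose lo i j : R := c i ord0 j - i.2.+1%:R^-1.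
pose hi i j : R := c i ord0 j + i.2.+1%:R^-1.
pose N (m : nat) : set V := if unpickle m is Some i then
  if `[< cbox (lo i) (hi i) `<=` M >] then obox (lo i) (hi i) else set0
  else set0.
have H : {ae mu, forall x m, N m x -> f x = 0}.
  apply: ae_foralln => m; rewrite /N.
  case: unpickle => [i|]; last exact: aeW.
  by case: asboolP => [/ae_eq0_obox//|_]; exact: aeW.
apply: filterS H => x H Mx.
suff [m Nm] : exists m, N m x by exact: H Nm.
have /nbhs_ballP[e /= e0 xeM] : nbhs x M by exact: open_nbhs_nbhs.
have e20 : 0 < e / 2 by rewrite divr_gt0.
have [k ke] : exists k : nat, k.+1%:R^-1 < e / 2.
  exists (Num.truncn (e / 2)^-1).
  rewrite invf_plt ?posrE//; exact: truncnS_gt.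
pose d : R := k.+1%:R^-1.
have d0 : 0 < d by rewrite invr_gt0.
have /choice[q qP] (j : 'I_n) : exists q : rat, `|ratr q - x ord0 j| < d.
  have : x ord0 j < x ord0 j + d by rewrite ltrDl.
  move=> /rat_in_itvoo[q]; rewrite in_itv/= => /andP[xq qx].
  by exists q; rewrite gtr0_norm ?subr_gt0// ltrBlDl.
pose i : 'rV[rat]_n * nat := (\row_j q j, k).
have ci j : c i ord0 j = ratr (q j) by rewrite !mxE.
exists (pickle i); rewrite /N pickleK; case: asboolP => [_ j|].
  have := qP j; rewrite /= in_itv /= /lo /hi ci -/d ltr_norml.
  by move=> /andP[h1 h2]; apply/andP; split; lra.
case=> y yc; apply: xeM; split => // l j; rewrite (ord1 l) /ball /=.
have := yc j; rewrite /= in_itv /= /lo /hi ci -/d => yj.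
have := qP j; rewrite !ltr_norml => /andP[h1 h2].
case/andP: yj => h3 h4; have ke' : d < e / 2 := ke.
change (- e < x ord0 j - y ord0 j < e); apply/andP; split; lra.
Qed.

End fundamental_lemma.

(** * Real test functions in the complex H^1_0 *)
Section complex_valued.
Local Notation normc := ComplexField.Normc.normc.
Context {R : realType} {n : nat}.
Local Notation V := 'rV[R]_n.
Local Notation mu := (@lebesgue_rV R n).
Implicit Types (v f : V -> R) (M : set V).

Definition cplx v : V -> R[i] := fun x => Complex (v x) 0.

Lemma normc_sqr (z : R[i]) : normc z ^+ 2 = complex.Re z ^+ 2 + complex.Im z ^+ 2.
Proof. by case: z => a b /=; rewrite sqr_sqrtr// addr_ge0// sqr_ge0. Qed.

Lemma normc_cplx v x : normc (cplx v x) = `|v x|.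
Proof. by rewrite /cplx /= expr0n addr0 sqrtr_sqr. Qed.

Lemma normc_ge0 (z : R[i]) : 0 <= normc z.
Proof. by case: z => a b; exact: sqrtr_ge0. Qed.

Lemma measurable_normc_sqr M (w : V -> R[i]) :
  measurable_fun M (@complex.Re R \o w) -> measurable_fun M (@complex.Im R \o w) ->
  measurable_fun M (fun x => normc (w x) ^+ 2).
Proof.
move=> mr mi; under eq_fun do rewrite normc_sqr.
apply: measurable_funD; first exact: (measurable_funX 2 mr).
exact: (measurable_funX 2 mi).
Qed.
Lemma cpartial_cplx i v : cpartial i (cplx v) = cplx (partial i v).
Proof.
apply/funext => x; rewrite /cpartial /cplx; congr Complex.
by rewrite (_ : _ \o _ = cst 0) ?partial_cst.
Qed.

Lemma real_test_vanishes M f : real_test M f -> vanishes_far f.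
Proof.
move=> [_ [C [cC _ fC]]]; have [r [_ Cr]] := compact_bounded cC.
have r1 : r < `|r| + 1 by rewrite (le_lt_trans (ler_norm _)) ?ltrDl.
exists (`|r| + 1) => x xr; apply: fC => Cx.
by have := Cr _ r1 _ Cx; rewrite /= leNgt xr.
Qed.

Lemma real_test_out M f x : real_test M f -> ~ M x -> f x = 0.
Proof. by move=> [_ [C [_ CM fC]]] Mx; apply: fC => /CM. Qed.

Lemma real_test_partial M i f : real_test M f -> real_test M (partial i f).
Proof.
move=> [sf [C [cC CM fC]]]; split; first exact: smooth_partial.
exists C; split=> // x Cx.
rewrite /partial (@near_eq_derive _ _ _ _ (cst 0)) ?derive_cst//.
have : nbhs x (~` C).
  apply: open_nbhs_nbhs; split => //; apply: closed_openC.
  by apply: compact_closed => //; exact: norm_hausdorff.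
by apply: filterS => y Cy; rewrite fC.
Qed.

Lemma real_testM M f g : real_test M f -> smooth_on setT g -> real_test M (f \* g).
Proof.
move=> [sf [C [cC CM fC]]] sg; split; first exact: smoothM.
by exists C; split=> // x /fC /= ->; rewrite mul0r.
Qed.

Lemma real_test_continuous M f : real_test M f -> continuous f.
Proof. by move=> [sf _]; exact: smooth_continuous. Qed.

Lemma integral_supp M (f : V -> \bar R) : (forall x, ~ M x -> f x = 0)%E ->
  (\int[mu]_(x in M) f x = \int[mu]_x f x)%E.
Proof.
move=> fM; rewrite integral_mkcond [RHS]integral_mkcond patch_setT.
apply: eq_integral => x _; rewrite patchE.
by have [//|xM] := boolP (x \in M); rewrite fM//; rewrite notin_setE in xM.
Qed.

Lemma test_function_cplx M v : real_test M v -> test_function M (cplx v).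
Proof.
move=> [sv [C [cC CM vC]]]; split; first exact: sv.
  exact: (smooth_cst 0).
by exists C; split=> // x /vC; rewrite /cplx => ->.
Qed.

Lemma test_function_Re M phi : test_function M phi ->
  real_test M (@complex.Re R \o phi).
Proof.
by move=> [s1 _ [C [cC CM fC]]]; split=> //; exists C; split=> // x /fC /= ->.
Qed.

Lemma test_function_Im M phi : test_function M phi ->
  real_test M (@complex.Im R \o phi).
Proof.
by move=> [_ s1 [C [cC CM fC]]]; split=> //; exists C; split=> // x /fC /= ->.
Qed.

Lemma integrable_test M v : real_test M v -> mu.-integrable setT (EFin \o v).
Proof.
move=> tv; apply: integrable_supp; first exact: real_test_continuous tv.
exact: real_test_vanishes tv.
Qed.

Lemma Rintegral_mul_partial M v r i : smooth_on setT v -> real_test M r ->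
  \int[mu]_(x in M) (v x * partial i r x) =
  - \int[mu]_(x in M) (partial i v x * r x).
Proof.
move=> sv tr; have tdr := real_test_partial i tr.
have trdv := real_testM tr (smooth_partial i sv).
have tdrv := real_testM tdr sv.
have := integral_partial i (smoothM sv tr.1)
  (vanishes_farMr v (real_test_vanishes tr)).
rewrite (partialM i sv tr.1).
rewrite (_ : (fun _ => _) = (fun x => ((partial i r \* v) x)%:E +
   ((r \* partial i v) x)%:E)%E); last first.
  by apply/funext => x; rewrite /= -EFinD [v x * _]mulrC.
rewrite integralD//; [|exact: integrable_test tdrv|exact: integrable_test trdv].
have f1 := integrable_fin_num measurableT (integrable_test tdrv).
have f2 := integrable_fin_num measurableT (integrable_test trdv).
move=> /eqP; rewrite -[X in (X + _)%E]fineK// -[X in (_ + X)%E]fineK//.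
rewrite -EFinD eqe addr_eq0 => /eqP h.
rewrite /Rintegral (@integral_supp M (fun x => (v x * partial i r x)%:E)); last first.
  by move=> x Mx; rewrite (real_test_out tdr Mx) mulr0.
rewrite (@integral_supp M (fun x => (partial i v x * r x)%:E)); last first.
  by move=> x Mx; rewrite (real_test_out tr Mx) mulr0.
have -> : (fun x => (v x * partial i r x)%:E) = EFin \o (partial i r \* v).
  by apply/funext => x /=; rewrite mulrC.
rewrite h; congr (- fine _); apply: eq_integral => x _ /=.
by rewrite mulrC.
Qed.

End complex_valued.

Section test_functions_H10.
Local Notation normc := ComplexField.Normc.normc.
Context {R : realType} {n : nat}.
Local Notation V := 'rV[R]_n.
Local Notation mu := (@lebesgue_rV R n).
Variable M : set V.
Hypothesis oM : open M.
Implicit Types (v f h : V -> R).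

Let mM : measurable M := open_measurable_rV oM.

Lemma measurable_test f : real_test M f -> measurable_fun M f.
Proof.
move=> tf; apply: measurable_funTS; apply: continuous_measurable_rV.
exact: real_test_continuous tf.
Qed.

Lemma sqr_integrable_test f : real_test M f ->
  mu.-integrable M (fun x => (f x ^+ 2)%:E).
Proof.
move=> tf; apply: integrableS (integrable_test (real_testM tf tf.1)) => //.
Qed.

Lemma sqr_integral_lty f : mu.-integrable M (fun x => (f x ^+ 2)%:E) ->
  (\int[mu]_(x in M) (f x ^+ 2)%:E < +oo)%E.
Proof.
move=> /integrableP[_]; congr (_ < _)%E; apply: eq_integral => x _.
by rewrite gee0_abs ?lee_fin ?sqr_ge0.
Qed.

Lemma sqr_integrableB f h : measurable_fun M f -> measurable_fun M h ->
  mu.-integrable M (fun x => (f x ^+ 2)%:E) ->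
  mu.-integrable M (fun x => (h x ^+ 2)%:E) ->
  mu.-integrable M (fun x => ((f x - h x) ^+ 2)%:E).
Proof.
move=> mf mh f2 h2.
have i2 := integrableD mM (integrableZl mM 2 f2) (integrableZl mM 2 h2).
apply: le_integrable i2 => //.
  by apply/measurable_EFinP; apply: measurable_funX; exact: measurable_funB.
move=> x _ /=; rewrite lee_fin [leLHS]ger0_norm ?sqr_ge0//.
apply: le_trans (ler_norm _).
by have := sqr_ge0 (f x + h x); rewrite !expr2; lra.
Qed.

Lemma integrable_mul_test f phi : measurable_fun M f ->
  mu.-integrable M (fun x => (f x ^+ 2)%:E) -> real_test M phi ->
  mu.-integrable M (fun x => (f x * phi x)%:E).
Proof.
move=> mf f2 tphi.
apply: le_integrable (integrableD mM f2 (sqr_integrable_test tphi)) => //.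
  by apply/measurable_EFinP; apply: measurable_funM => //; exact: measurable_test.
move=> x _ /=; rewrite lee_fin [leRHS]ger0_norm ?addr_ge0 ?sqr_ge0//.
rewrite ler_norml; have := sqr_ge0 (f x + phi x); have := sqr_ge0 (f x - phi x).
have := sqr_ge0 (f x); have := sqr_ge0 (phi x).
by rewrite !expr2 => *; apply/andP; split; lra.
Qed.

Lemma L2_integrable u : L2 M u ->
  mu.-integrable M (fun x => (complex.Re (u x) ^+ 2)%:E) /\
  mu.-integrable M (fun x => (complex.Im (u x) ^+ 2)%:E).
Proof.
move=> [mr mi u2].
have i2 : mu.-integrable M (fun x => (normc (u x) ^+ 2)%:E).
  apply/integrableP; split.
    by apply/measurable_EFinP; exact: measurable_normc_sqr.
  under eq_integral => x _ do rewrite gee0_abs ?lee_fin ?sqr_ge0//.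
  exact: u2.
split; apply: le_integrable i2 => //.
- by apply/measurable_EFinP; exact: (measurable_funX 2 mr).
- move=> x _; rewrite /= lee_fin !ger0_norm ?sqr_ge0//.
  by rewrite normc_sqr lerDl sqr_ge0.
- by apply/measurable_EFinP; exact: (measurable_funX 2 mi).
- move=> x _; rewrite /= lee_fin !ger0_norm ?sqr_ge0//.
  by rewrite normc_sqr lerDr sqr_ge0.
Qed.

Lemma L2_cplx v : real_test M v -> L2 M (cplx v).
Proof.
move=> tv; split; first exact: (measurable_test tv).
  exact: (@measurable_cst _ _ _ _ M (0 : R)).
rewrite /L2norm_sqr; under eq_integral do rewrite normc_cplx real_normK ?num_real//.
exact/sqr_integral_lty/sqr_integrable_test.
Qed.

Lemma complex_eq_opp (a b c d : R) : Complex a b = - Complex c d ->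
  a = - c /\ b = - d.
Proof. by case. Qed.

Lemma Re_mul_cplx (z : R[i]) f x : complex.Re (z * cplx f x) = complex.Re z * f x.
Proof. by case: z => a b /=; rewrite mulr0 subr0. Qed.

Lemma Im_mul_cplx (z : R[i]) f x : complex.Im (z * cplx f x) = complex.Im z * f x.
Proof. by case: z => a b /=; rewrite mulr0 add0r. Qed.

Lemma Re_cplx_mul (z : R[i]) f x : complex.Re (cplx f x * z) = f x * complex.Re z.
Proof. by rewrite mulrC Re_mul_cplx mulrC. Qed.

Lemma Im_cplx_mul (z : R[i]) f x : complex.Im (cplx f x * z) = f x * complex.Im z.
Proof. by rewrite mulrC Im_mul_cplx mulrC. Qed.

Lemma weak_partial_cplx v i : real_test M v ->
  weak_partial M i (cplx v) (cplx (partial i v)).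
Proof.
move=> [sv _] phi tphi; rewrite /cintegral.
under eq_Rintegral do rewrite Re_cplx_mul.
under [X in Complex _ X = _]eq_Rintegral do rewrite Im_cplx_mul.
rewrite /cpartial /=.
rewrite (Rintegral_mul_partial i sv (test_function_Re tphi)).
rewrite (Rintegral_mul_partial i sv (test_function_Im tphi)).
under [in RHS]eq_Rintegral do rewrite Re_cplx_mul.
by under [X in _ = - Complex _ X]eq_Rintegral do rewrite Im_cplx_mul.
Qed.

Lemma weak_grad_cplx v : real_test M v ->
  weak_grad M (cplx v) (fun i => cplx (partial i v)).
Proof.
move=> tv i; split; last exact: weak_partial_cplx.
by apply: L2_cplx; exact: real_test_partial.
Qed.

(** Testing against real functions only, the difference of the two gradients
    has real and imaginary parts to which the fundamental lemma applies. *)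
Lemma weak_grad_unique v g : real_test M v -> weak_grad M (cplx v) g ->
  forall i, {ae mu, forall x, M x -> g i x = cplx (partial i v) x}.
Proof.
move=> tv wg i; have [L2g wp] := wg i.
have [r2 i2] := L2_integrable L2g; have [mr mi _] := L2g.
have tdv := real_test_partial i tv.
have H phi : real_test M phi ->
    \int[mu]_(x in M) (complex.Re (g i x) * phi x) =
      \int[mu]_(x in M) (partial i v x * phi x) /\
    \int[mu]_(x in M) (complex.Im (g i x) * phi x) = 0.
  move=> tphi; have := wp _ (test_function_cplx tphi).
  rewrite cpartial_cplx /cintegral => /complex_eq_opp[].
  under eq_Rintegral do rewrite Re_mul_cplx.
  rewrite (Rintegral_mul_partial i tv.1 tphi) => /oppr_inj e1.
  rewrite {}e1.
  under eq_Rintegral do rewrite Im_mul_cplx /= mul0r.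
  rewrite /Rintegral integral0 => /eqP; rewrite eq_sym oppr_eq0 => /eqP h; split.
    by congr fine; apply: eq_integral => x _; rewrite Re_mul_cplx.
  by rewrite -[RHS]h; congr fine; apply: eq_integral => x _; rewrite Im_mul_cplx.
have a1 : {ae mu, forall x, M x -> complex.Re (g i x) - partial i v x = 0}.
  apply: (ae_eq0_test oM).
  - by apply: measurable_funB => //; exact: measurable_test.
  - by apply/sqr_integral_lty/sqr_integrableB => //;
      [exact: measurable_test|exact: sqr_integrable_test].
  - move=> phi tphi; under eq_Rintegral do rewrite mulrBl.
    rewrite RintegralB//; first by rewrite (H _ tphi).1 subrr.
      exact: (integrable_mul_test mr).
    apply: (integrable_mul_test (measurable_test tdv)) => //.
    exact: sqr_integrable_test.
have a2 : {ae mu, forall x, M x -> complex.Im (g i x) = 0}.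
  apply: (ae_eq0_test oM) => //.
  - exact: sqr_integral_lty i2.
  - by move=> phi /H[].
apply: filterS2 a1 a2 => x h1 h2 Mx.
have := h1 Mx; have := h2 Mx; case: (g i x) => a b /= -> /eqP.
by rewrite subr_eq0 => /eqP ->.
Qed.

Lemma measurable_grad_norm g : (forall i, L2 M (g i)) ->
  measurable_fun M (fun x => (\sum_(i < n) normc (g i x) ^+ 2)%:E).
Proof.
move=> L2g; apply/measurable_EFinP; apply: measurable_sum => i.
by have [mr mi _] := L2g i; exact: measurable_normc_sqr.
Qed.

Lemma nablaP u : H1 M u -> weak_grad M u (nabla M u).
Proof. by move=> [_ [g wg]]; apply: (xgetPex (fun _ _ => 0)); exists g. Qed.

Lemma H1_cplx v : real_test M v -> H1 M (cplx v).
Proof.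
move=> tv; split; first exact: L2_cplx.
by exists (fun i => cplx (partial i v)); exact: weak_grad_cplx.
Qed.

(** Whatever weak gradient [nabla] selects, it is almost everywhere the classical one. *)
Lemma nabla_cplx v : real_test M v ->
  {ae mu, forall x, M x -> forall i, nabla M (cplx v) i x = cplx (partial i v) x}.
Proof.
move=> tv; have := weak_grad_unique tv (nablaP (H1_cplx tv)) => H.
have : {ae mu, forall x i, M x -> nabla M (cplx v) i x = cplx (partial i v) x}.
  by apply: filter_forall => i; exact: H.
by apply: filterS => x Hx Mx i; exact: Hx.
Qed.

End test_functions_H10.

(** * Energy and mass of smooth functions on R^n *)
Section energy.
Context {R : realType} {n : nat}.
Local Notation V := 'rV[R]_n.
Local Notation mu := (@lebesgue_rV R n).
Implicit Types (v f h : V -> R) (M : set V).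

(** [energy] and [mass] are the functionals [F_] and [J_] of a real function on
    the whole space, where they are invariant under translation; [F_cplx] and
    [J_cplx] link the two versions. *)
Definition energy_density (lambda : R) v : V -> R := fun x =>
  \sum_(i < n) partial i v x ^+ 2 + lambda * v x ^+ 2.

Definition energy (lambda : R) v : R := \int[mu]_x (energy_density lambda v x).

Definition mass (p : R) v : R := \int[mu]_x (`|v x| `^ (p + 1)).

Lemma energy_density_smooth lambda v : smooth_on setT v ->
  smooth_on setT (energy_density lambda v).
Proof.
move=> sv.
apply: (@smoothD _ _ (fun x => \sum_(i < n) partial i v x ^+ 2)
  (fun x => lambda * v x ^+ 2)).
  by apply: smooth_sum => i; apply: smoothM; exact: smooth_partial.
by apply: smoothZ; exact: smoothM.
Qed.

Lemma energy_density_vanishes lambda v : vanishes_far v ->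
  vanishes_far (energy_density lambda v).
Proof.
move=> vv.
apply: (@vanishes_farD _ _ (fun x => \sum_(i < n) partial i v x ^+ 2)
  (fun x => lambda * v x ^+ 2)).
  apply: vanishes_far_sum => i; apply: vanishes_farMl.
  exact: vanishes_far_partial.
by apply: vanishes_farMr; exact: vanishes_farMl.
Qed.

Lemma energy_density_integrable lambda v : smooth_on setT v -> vanishes_far v ->
  mu.-integrable setT (EFin \o energy_density lambda v).
Proof.
move=> sv vv; apply: integrable_supp; last exact: energy_density_vanishes.
by apply: smooth_continuous; exact: energy_density_smooth.
Qed.

Lemma energyE lambda v : smooth_on setT v -> vanishes_far v ->
  ((energy lambda v)%:E = \int[mu]_x (energy_density lambda v x)%:E)%E.
Proof.
by move=> sv vv; rewrite fineK//; apply: integrable_fin_num => //;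
  exact: energy_density_integrable.
Qed.

Lemma measurable_norm_powR p v : continuous v ->
  measurable_fun setT (fun x => `|v x| `^ (p + 1)).
Proof.
move=> cv; have mv : measurable_fun setT (fun x => `|v x|).
  by apply: measurableT_comp => //; exact: continuous_measurable_rV.
apply: (@measurableT_comp _ _ _ _ _ _ (fun y : R => y `^ (p + 1))) mv.
exact: measurable_powR.
Qed.

Lemma mass_integrable p v : 0 < p -> continuous v -> vanishes_far v ->
  mu.-integrable setT (fun x => (`|v x| `^ (p + 1))%:E).
Proof.
move=> p0 cv vv; have [C C0 vC] := bounded_supp cv vv; have [r vr] := vv.
have p10 : 0 < p + 1 by rewrite addr_gt0.
apply: (@dominated_integrable _ _ _ (C `^ (p + 1)) r).
- exact: measurable_norm_powR.
- by move=> x; rewrite ger0_norm ?powR_ge0// ge0_ler_powR ?nnegrE// ltW.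
- by move=> x /vr ->; rewrite normr0 powR0// gt_eqF.
Qed.

Lemma massE p v : 0 < p -> continuous v -> vanishes_far v ->
  ((mass p v)%:E = \int[mu]_x (`|v x| `^ (p + 1))%:E)%E.
Proof.
by move=> p0 cv vv; rewrite fineK//; apply: integrable_fin_num => //;
  exact: mass_integrable.
Qed.

Section on_open_set.
Variable M : set V.
Hypothesis oM : open M.
Let mM : measurable M := open_measurable_rV oM.

Lemma grad_norm_nabla_cplx v : real_test M v ->
  grad_norm_sqr M (nabla M (cplx v)) =
  (\int[mu]_(x in M) (\sum_(i < n) partial i v x ^+ 2)%:E)%E.
Proof.
move=> tv; have wg := nablaP (H1_cplx oM tv).
apply: ge0_ae_eq_integral => //.
- by apply: measurable_grad_norm => i; have [] := wg i.
- apply/measurable_EFinP; apply: measurable_sum => i; apply: measurable_funX.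
  by apply: measurable_test => //; exact: real_test_partial.
- by move=> x _; rewrite lee_fin sumr_ge0// => i _; exact: sqr_ge0.
- by move=> x _; rewrite lee_fin sumr_ge0// => i _; exact: sqr_ge0.
- apply: filterS (nabla_cplx oM tv) => x H Mx; congr (_%:E).
  by apply: eq_bigr => i _; rewrite H// normc_cplx real_normK ?num_real.
Qed.

Lemma H10_cplx v : real_test M v -> H10 M (cplx v).
Proof.
move=> tv; split; first exact: H1_cplx.
move=> e e0; exists (cplx v); first exact: test_function_cplx.
have wg := nablaP (H1_cplx oM tv).
rewrite [X in (X + _)%E](_ : _ = 0%E); last first.
  apply: integral0_eq => x _.
  rewrite (_ : (_ \- _) x = 0); last exact: subrr.
  by rewrite ComplexField.Normc.normc0 expr0n.
rewrite add0e [X in (X < _)%E](_ : _ = 0%E) ?lte_fin//.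
rewrite /grad_norm_sqr.
rewrite -[RHS](@integral0 _ _ _ mu M).
apply: ge0_ae_eq_integral => //.
- apply/measurable_EFinP; apply: measurable_sum => i.
  rewrite cpartial_cplx; under eq_fun do rewrite normc_sqr /=.
  have [[mr mi _] _] := wg i; have tdv := measurable_test (real_test_partial i tv).
  apply: measurable_funD; apply: measurable_funX.
    rewrite [X in measurable_fun _ X](_ : _ =
      (complex.Re (R:=R) \o nabla M (cplx v) i) \- partial i v).
      exact: measurable_funB.
    by apply/funext => x /=; case: (nabla M (cplx v) i x).
  rewrite [X in measurable_fun _ X](_ : _ =
    complex.Im (R:=R) \o nabla M (cplx v) i) //.
  by apply/funext => x /=; case: (nabla M (cplx v) i x) => a b /=; rewrite subr0.
- by move=> x _; rewrite lee_fin sumr_ge0// => i _; exact: sqr_ge0.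
- apply: filterS (nabla_cplx oM tv) => x H Mx; congr (_%:E).
  apply: big1 => i _; rewrite (_ : (_ \- _) x = 0); last first.
    by rewrite /= H// cpartial_cplx subrr.
  by rewrite ComplexField.Normc.normc0 expr0n.
Qed.

Lemma F_cplx lambda v : 0 <= lambda -> real_test M v ->
  F_ lambda M (cplx v) = (energy lambda v)%:E.
Proof.
move=> l0 tv; have vv := real_test_vanishes tv.
rewrite /F_ grad_norm_nabla_cplx// /L2norm_sqr.
rewrite energyE//; last by case: tv.
rewrite -(@integral_supp _ _ M); last first.
  move=> x Mx; rewrite /energy_density.
  rewrite big1 ?(real_test_out tv Mx) ?expr0n ?mulr0 ?addr0//.
  by move=> i _; rewrite (real_test_out (real_test_partial i tv) Mx) expr0n.
under [in RHS]eq_integral do rewrite /energy_density EFinD EFinM.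
rewrite ge0_integralD//.
- rewrite ge0_integralZl//.
  + congr (_ + _ * _)%E; apply: eq_integral => x _.
    by rewrite normc_cplx real_normK ?num_real.
  + apply/measurable_EFinP; apply: measurable_funX; exact: measurable_test.
  + by move=> x _; rewrite lee_fin sqr_ge0.
- by move=> x _; rewrite lee_fin sumr_ge0// => i _; exact: sqr_ge0.
- apply/measurable_EFinP; apply: measurable_sum => i; apply: measurable_funX.
  by apply: measurable_test => //; exact: real_test_partial.
- by move=> x _; rewrite -EFinM lee_fin mulr_ge0// sqr_ge0.
- apply/measurable_EFinP; apply: measurable_funM => //.
  by apply: measurable_funX; exact: measurable_test.
Qed.

Lemma J_cplx p v : 0 < p -> real_test M v -> J_ p M (cplx v) = (mass p v)%:E.
Proof.
move=> p0 tv; have vv := real_test_vanishes tv.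
rewrite (massE p0 (real_test_continuous tv) vv).
rewrite /J_ -(@integral_supp _ _ M); last first.
  by move=> x Mx; rewrite (real_test_out tv Mx) normr0 powR0// gt_eqF// addr_gt0.
by apply: eq_integral => x _; rewrite normc_cplx.
Qed.

End on_open_set.

Lemma energy_translate lambda v (h : V) : smooth_on setT v ->
  energy lambda (fun x => v (x + h)) = energy lambda v.
Proof.
move=> sv; rewrite /energy /Rintegral; congr fine.
have mE : measurable_fun setT (fun x => (energy_density lambda v x)%:E).
  apply/measurable_EFinP; apply: continuous_measurable_rV.
  by apply: smooth_continuous; exact: energy_density_smooth.
rewrite -[RHS](integral_translate h mE); apply: eq_integral => x _.
congr (_%:E); rewrite /energy_density; congr (_ + _).
by apply: eq_bigr => i _; rewrite (partial_translate i h sv).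
Qed.

Lemma mass_translate p v (h : V) : continuous v ->
  mass p (fun x => v (x + h)) = mass p v.
Proof.
move=> cv; rewrite /mass /Rintegral; congr fine.
have mE : measurable_fun setT (fun x => (`|v x| `^ (p + 1))%:E).
  by apply/measurable_EFinP; exact: measurable_norm_powR.
by rewrite -[RHS](integral_translate h mE).
Qed.

Lemma energyZ lambda (c : R) v : smooth_on setT v -> vanishes_far v ->
  energy lambda (fun x => c * v x) = c ^+ 2 * energy lambda v.
Proof.
move=> sv vv; rewrite /energy -RintegralZl//; last exact: energy_density_integrable.
congr fine; apply: eq_integral => x _; congr (_%:E).
rewrite /energy_density mulrDr mulr_sumr exprMn mulrCA; congr (_ + _).
by apply: eq_bigr => i _; rewrite partialZ// exprMn.
Qed.

Lemma massZ p (c : R) v : 0 < p -> 0 <= c -> continuous v -> vanishes_far v ->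
  mass p (fun x => c * v x) = c `^ (p + 1) * mass p v.
Proof.
move=> p0 c0 cv vv; rewrite /mass -RintegralZl//; last exact: mass_integrable.
congr fine; apply: eq_integral => x _; congr (_%:E).
by rewrite normrM ger0_norm// powRM.
Qed.

End energy.

(** * Competitors on the whole space *)
Section lower_bound.
Context {R : realType} {n : nat}.
Local Notation V := 'rV[R]_n.
Local Notation dir i := (delta_mx ord0 i : 'rV[R]_n).
Implicit Types (v : V -> R).

Lemma norm_le_coord (x : V) (c : R) : 0 <= c ->
  (forall i, `|x ord0 i| <= c) -> `|x| <= c.
Proof.
move=> c0 xc; rewrite [leLHS]/Num.norm /= mx_normrE.
by apply/bigmax_leP; split=> // -[i j] _ /=; rewrite (ord1 i).
Qed.

(** A multiple of a basis vector longer than the sum of the radii of [K] and of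
    the support, plus 1, separates the two. *)
Lemma translate_off (K : set V) (r : R) v (i : 'I_n) : closed K ->
  (forall x, K x -> `|x| <= r) -> smooth_on setT v -> vanishes_far v ->
  exists h, real_test (~` K) (fun x => v (x + h)).
Proof.
move=> cK Kr sv [s vs].
pose h : V := (`|r| + `|s| + 1) *: dir i.
have hn : `|r| + `|s| + 1 <= `|h|.
  apply: le_trans (coord_le_norm h i); rewrite !mxE !eqxx mulr1; exact: ler_norm.
exists h; split; first exact: smooth_translate.
exists [set x : V | `|x + h| <= s]; split.
- apply: bounded_closed_compact.
    exists (s + `|h|); split; first exact: num_real.
    move=> M sM x /= xs; apply: le_trans (ltW sM).
    by rewrite -{1}(addrK h x) (le_trans (ler_normB _ _))// lerD2r.
  rewrite (_ : [set x | _] = (fun x : V => x + h) @^-1` [set x | `|x| <= s])//.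
  apply: closed_comp; last exact: (@closed_norm_ball R n s).
  by move=> x _; exact: continuous_translate.
- move=> x /= xs /Kr xr; have := ler_normB (x + h) x.
  rewrite addrC addKr; have := ler_norm r; have := ler_norm s; lra.
- by move=> x /= /negP; rewrite -ltNge => /vs.
Qed.

Lemma energy_ge0 lambda v : 0 <= lambda -> 0 <= energy lambda v.
Proof.
move=> l0; apply: Rintegral_ge0 => x _; rewrite /energy_density.
apply: addr_ge0; first by apply: sumr_ge0 => i _; exact: sqr_ge0.
by apply: mulr_ge0 => //; exact: sqr_ge0.
Qed.

(** This is where the exterior domain loses to the whole space: the infimum on
    [M] is bounded by functions that do not know of [K]. *)
Lemma I_le_energy (K : set V) (r : R) (lambda p beta : R) (i : 'I_n) v :
  closed K -> (forall x, K x -> `|x| <= r) -> 0 <= lambda -> 0 < p ->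
  smooth_on setT v -> vanishes_far v -> mass p v = beta ->
  (I_ lambda p beta (~` K) <= (energy lambda v)%:E)%E.
Proof.
move=> cK Kr l0 p0 sv vv mv; have oM : open (~` K) by exact: closed_openC.
have [h th] := translate_off i cK Kr sv vv.
rewrite -(energy_translate lambda h sv) -(F_cplx oM l0 th).
apply: ereal_inf_lbound; exists (cplx (fun x => v (x + h))) => //; split.
  exact: H10_cplx.
rewrite (J_cplx p0 th) mass_translate ?mv//; exact: smooth_continuous.
Qed.

(** Scaling [v] down to mass [beta] uses a factor [c] with [s * c <= 1]; a mass
    that is only almost [beta], as for the approximations of a minimizer,
    corresponds to [s] slightly below 1. *)
Lemma energy_lower_bound (K : set V) (r : R) (lambda p beta e s : R) (i : 'I_n) v :
  closed K -> (forall x, K x -> `|x| <= r) -> 0 <= lambda -> 0 < p -> 0 < beta ->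
  I_ lambda p beta (~` K) = e%:E ->
  smooth_on setT v -> vanishes_far v -> 0 < s -> beta * s `^ (p + 1) <= mass p v ->
  s ^+ 2 * e <= energy lambda v.
Proof.
move=> cK Kr l0 p0 b0 Ie sv vv s0 sm.
have cv := smooth_continuous sv.
have p10 : 0 < p + 1 by rewrite addr_gt0.
have m0 : 0 < mass p v by apply: lt_le_trans sm; rewrite mulr_gt0// powR_gt0.
pose c := (beta / mass p v) `^ (p + 1)^-1.
have bm0 : 0 < beta / mass p v by rewrite divr_gt0.
have c0 : 0 <= c by exact: powR_ge0.
have cp : c `^ (p + 1) = beta / mass p v.
  by rewrite -powRrM mulVf ?gt_eqF// powRr1// ltW.
have sc1 : s * c <= 1.
  have -> : s = (s `^ (p + 1)) `^ (p + 1)^-1.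
    by rewrite -powRrM mulfV ?gt_eqF// powRr1// ltW.
  rewrite -powRM ?powR_ge0// ?(ltW bm0)//.
  have one : 1 = 1 `^ (p + 1)^-1 :> R by rewrite powR1.
  rewrite [leRHS]one ge0_ler_powR ?nnegrE ?invr_ge0 ?(ltW p10)//.
    by rewrite mulr_ge0 ?powR_ge0 ?ltW.
  by rewrite mulrCA mulrA ler_pdivrMr// mul1r.
have : (I_ lambda p beta (~` K) <= (energy lambda (fun x => c * v x))%:E)%E.
  apply: (I_le_energy i cK Kr l0 p0 _ _ _).
  - exact: smoothZ.
  - exact: (vanishes_farMr (cst c) vv).
  - by rewrite massZ// cp divfK// gt_eqF.
rewrite Ie lee_fin energyZ// => H.
apply: (@le_trans _ _ (s ^+ 2 * (c ^+ 2 * energy lambda v))).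
  by rewrite ler_wpM2l// sqr_ge0.
rewrite mulrA -exprMn ler_piMl ?energy_ge0//.
by rewrite expr_le1// mulr_ge0// ltW.
Qed.

End lower_bound.

(** * The barrier *)
Section barrier.
Context {R : realType} {n : nat}.
Local Notation V := 'rV[R]_n.
Implicit Types (v : V -> R) (z : V).

Definition sqdist z (x : V) : R := \sum_(i < n) (x ord0 i - z ord0 i) ^+ 2.

(** The operator [lambda - Laplacian]. *)
Definition schrodinger (lambda : R) v : V -> R := fun x =>
  lambda * v x - \sum_(i < n) partial i (partial i v) x.

Lemma smooth_schrodinger lambda v : smooth_on setT v ->
  smooth_on setT (schrodinger lambda v).
Proof.
move=> sv; rewrite (_ : schrodinger lambda v = (fun x => lambda * v x) \+
    (fun x => -1 * \sum_(i < n) partial i (partial i v) x)); last first.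
  by apply/funext => x; rewrite /schrodinger /= mulN1r.
apply: smoothD; first exact: smoothZ.
by apply: smoothZ; apply: smooth_sum => i; do 2 apply: smooth_partial.
Qed.

Lemma partial_sum (I : Type) (r : seq I) (F : I -> V -> R) i :
  (forall j, smooth_on setT (F j)) ->
  partial i (fun x => \sum_(j <- r) F j x) =
  (fun x => \sum_(j <- r) partial i (F j) x).
Proof.
move=> sF; elim: r => [|j r IH].
  rewrite (_ : (fun x => _) = cst 0); last by apply/funext => x; rewrite big_nil.
  by rewrite partial_cst; apply/funext => x; rewrite big_nil.
rewrite (_ : (fun x => _) = F j \+ (fun x => \sum_(k <- r) F k x)); last first.
  by apply/funext => x; rewrite big_cons.
rewrite partialD//; last exact: smooth_sum.
by rewrite IH; apply/funext => x; rewrite big_cons.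
Qed.

(* The coordinates of [x - z]. *)
Let y z j : V -> R := (fun x => x ord0 j) \+ cst (- z ord0 j).

Let sy z j : smooth_on setT (y z j).
Proof. by apply: smoothD; [exact: smooth_coord|exact: smooth_cst]. Qed.

Let dy z i j : partial i (y z j) = cst (j == i)%:R.
Proof.
rewrite partialD; [|exact: smooth_coord|exact: smooth_cst].
rewrite partial_cst (partialE (is_derive_coord i j)).
by apply/funext => x /=; rewrite addr0.
Qed.

(* The function [S - |x - z|^2]. *)
Let q S z : V -> R := cst S \+ (fun x => - 1 * \sum_(j < n) (y z j \* y z j) x).

Let qE S z x : q S z x = S - sqdist z x.
Proof. by rewrite /q /= mulN1r. Qed.

Let sq S z : smooth_on setT (q S z).
Proof.
apply: smoothD; first exact: smooth_cst.
by apply: smoothZ; apply: smooth_sum => j; exact: smoothM.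
Qed.

Let dq S z i : partial i (q S z) = (fun x => - 2 * y z i x).
Proof.
have ss : smooth_on setT (fun x => \sum_(j < n) (y z j \* y z j) x).
  by apply: smooth_sum => j; exact: smoothM.
rewrite partialD; [|exact: smooth_cst|exact: smoothZ].
rewrite partial_cst (partialZ _ i ss).
rewrite (partial_sum _ i (fun j => smoothM (sy z j) (sy z j))).
apply/funext => x /=; rewrite add0r (bigD1 i)//= big1 ?addr0 => [|j ji].
  by rewrite (partialM i (sy z i) (sy z i)) dy /= eqxx mulr1n; ring.
by rewrite (partialM i (sy z j) (sy z j)) dy /= (negbTE ji) mulr0n; ring.
Qed.

(** Hopf's barrier is [psi = exp (- al / s)] with [s = S - |x - z|^2], extended
    by 0.  With [D = |x - z|^2] one finds
    [s^4 (lambda - Laplacian) psi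
       = (lambda s^4 + 2 n al s^2 - 4 al (al - 2 s) D) psi],
    where the term in [al^2 D] wins for large [al] as long as [D >= rho]. *)
Lemma barrier (lambda rho S : R) z : 0 < lambda -> 0 < rho -> 0 < S ->
  exists psi : V -> R, [/\ smooth_on setT psi, vanishes_far psi,
    (forall x, 0 <= psi x),
    (forall x, rho <= sqdist z x -> schrodinger lambda psi x <= 0) &
    (forall x, rho <= sqdist z x < S -> schrodinger lambda psi x < 0)].
Proof.
move=> l0 r0 S0.
(* As [0 < s <= S] and [D >= rho], it suffices that [al - 2 S > A] and
   [al >= 1]: then [4 al (al - 2 s) D > al (4 rho A)], which bounds the two
   positive terms. *)
pose A := (2 * n%:R * S ^+ 2 + lambda * S ^+ 4) / (4 * rho).
have A0 : 0 < A.
  rewrite divr_gt0 ?mulr_gt0// ltr_wpDl ?mulr_gt0 ?exprn_gt0//.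
  by apply: mulr_ge0; [exact: mulr_ge0|exact: sqr_ge0].
pose al := 2 * S + A + 1; have al0 : 0 < al by rewrite /al; lra.
pose psi := flat al 0 \o q S z.
have spsi : smooth_on setT psi by exact: smooth_flat.
have d1 i : partial i psi = (fun x => al * (flat al 2 \o q S z) x) \*
    (fun x => - 2 * y z i x).
  apply: partialE => x.
  apply: (is_derive_eq (is_derive_flat_comp al0 0 i x (sq S z))).
  by rewrite mul0r subr0 dq.
have d2 i x : partial i (partial i psi) x =
    4 * al * (al * flat al 4 (q S z x) - 2 * flat al 3 (q S z x)) * (y z i x) ^+ 2
    - 2 * al * flat al 2 (q S z x).
  have sf2 := smooth_flat 2 al0 (sq S z).
  rewrite d1 (partialM i (smoothZ al sf2) (smoothZ (- 2) (sy z i))).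
  rewrite (partialZ al i sf2) (partialZ (- 2) i (sy z i)).
  rewrite dy (partialE (fun x => is_derive_flat_comp al0 2 i x (sq S z))).
  by rewrite /= eqxx mulr1n dq; ring.
have lapE x : schrodinger lambda psi x = lambda * flat al 0 (q S z x) -
   (4 * al * (al * flat al 4 (q S z x) - 2 * flat al 3 (q S z x)) * sqdist z x
    - n%:R * (2 * al * flat al 2 (q S z x))).
  rewrite /schrodinger; congr (_ - _).
  under eq_bigr do rewrite d2.
  rewrite big_split /= -mulr_sumr; congr (_ + _).
  by rewrite sumr_const card_ord mulNrn [n%:R * _]mulr_natl.
have neg x : rho <= sqdist z x < S -> schrodinger lambda psi x < 0.
  move=> /andP[rx xS]; rewrite lapE.
  have s0 : 0 < q S z x by rewrite qE subr_gt0.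
  have sS : q S z x <= S by rewrite qE; lra.
  set s := q S z x in s0 sS *; set D := sqdist z x in rx *.
  set E4 := flat al 4 s.
  have E40 : 0 < E4 by exact: flat_gt0.
  have e3 : flat al 3 s = s * E4 by rewrite flatS.
  have e2 : flat al 2 s = s ^+ 2 * E4 by rewrite flatS// e3; ring.
  have e0 : flat al 0 s = s ^+ 4 * E4.
    by rewrite flatS// flatS// e2; ring.
  rewrite e0 e2 e3.
  suff H : 0 < 4 * al * (al - 2 * s) * D - n%:R * (2 * al * s ^+ 2)
      - lambda * s ^+ 4.
    have := mulr_gt0 H E40; lra.
  have a0 : 4 * rho * A = 2 * n%:R * S ^+ 2 + lambda * S ^+ 4.
    by rewrite mulrC divfK// mulf_neq0 ?gt_eqF.
  have n0 : 0 <= n%:R :> R by exact: ler0n.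
  have sS2 : s ^+ 2 <= S ^+ 2 by rewrite ler_sqr ?nnegrE// ltW.
  have sS4 : s ^+ 4 <= S ^+ 4 by rewrite ler_pXn2r ?nnegrE// ltW.
  have h1 : 4 * al * (A + 1) * rho <= 4 * al * (al - 2 * s) * D.
    rewrite ler_pM ?mulr_ge0 ?(ltW al0) ?(ltW r0)//; first lra.
    by rewrite ler_wpM2l ?mulr_ge0 ?(ltW al0)// /al; lra.
  have h2 : n%:R * (2 * al * s ^+ 2) <= n%:R * (2 * al * S ^+ 2).
    by rewrite !ler_wpM2l// mulr_ge0// ltW.
  have h3 : lambda * s ^+ 4 <= lambda * S ^+ 4 by rewrite ler_wpM2l// ltW.
  have h4 : lambda * S ^+ 4 * 1 <= lambda * S ^+ 4 * al.
    rewrite ler_wpM2l ?mulr_ge0 ?exprn_ge0 ?(ltW l0) ?(ltW S0)// /al; lra.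
  have h5 : 0 < al * rho by exact: mulr_gt0.
  have h6 : 4 * al * (A + 1) * rho = al * (4 * rho * A) + 4 * (al * rho) by ring.
  rewrite h6 a0 in h1; lra.
exists psi; split=> //.
- exists (S + 1 + `|z|) => x xS; rewrite /psi /= flat_eq0// qE subr_le0 leNgt.
  apply/negP => dS; move: xS; apply/negP; rewrite -leNgt.
  rewrite -{1}(subrK z x) (le_trans (ler_normD _ _))// lerD2r.
  apply: norm_le_coord => [|i]; first by rewrite addr_ge0// ltW.
  have : (x ord0 i - z ord0 i) ^+ 2 < S.
    apply: le_lt_trans dS; rewrite /sqdist (bigD1 i)//= lerDl sumr_ge0// => j _.
    exact: sqr_ge0.
  rewrite !mxE -real_normK ?num_real//; set t := `|_|; rewrite expr2 => tS.
  have t0 : 0 <= t by exact: normr_ge0.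
  rewrite leNgt; apply/negP => t1; nra.
- by move=> x; exact: flat_ge0.
- move=> x rx; have [xS|xS] := ltP (sqdist z x) S.
    by apply: ltW; apply: neg; rewrite rx.
  rewrite lapE !flat_eq0 ?qE ?subr_le0//; lra.
Qed.

End barrier.

(** * The smoothed modulus *)
Section modulus.
Local Notation normc := ComplexField.Normc.normc.
Context {R : realType} {n : nat}.
Local Notation V := 'rV[R]_n.
Implicit Types (phi : V -> R[i]) (M : set V).

(** Subtracting [e] makes it vanish where [phi] does, so that its support is
    compact. *)
Definition modulus (e : R) phi : V -> R := fun x =>
  Num.sqrt (normc (phi x) ^+ 2 + e ^+ 2) - e.

Lemma modulus_bounds e phi x : 0 < e ->
  [/\ 0 <= modulus e phi x, modulus e phi x <= normc (phi x) &
      normc (phi x) <= modulus e phi x + e].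
Proof.
move=> e0; set N := normc (phi x).
have N0 : 0 <= N by exact: normc_ge0.
rewrite /modulus -/N; set q := Num.sqrt _.
have q0 : 0 <= q by exact: sqrtr_ge0.
have qq : q ^+ 2 = N ^+ 2 + e ^+ 2 by rewrite sqr_sqrtr// addr_ge0// sqr_ge0.
split.
- rewrite subr_ge0 -(@ler_sqr _ e q) ?nnegrE// ?(ltW e0)// qq.
  by rewrite lerDr sqr_ge0.
- rewrite lerBlDr -(@ler_sqr _ q) ?nnegrE ?addr_ge0 ?(ltW e0)// qq.
  by rewrite sqrrD lerD2r lerDl mulrn_wge0// mulr_ge0// ltW.
- by rewrite subrK -(@ler_sqr _ N) ?nnegrE// qq lerDl sqr_ge0.
Qed.

Lemma normc_sqr_smooth M phi : test_function M phi ->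
  smooth_on setT (fun x => normc (phi x) ^+ 2).
Proof.
move=> [sr si _]; under eq_fun do rewrite normc_sqr.
apply: (@smoothD _ _ (fun x => complex.Re (phi x) ^+ 2)
                     (fun x => complex.Im (phi x) ^+ 2)).
  exact: (smoothM sr sr).
exact: (smoothM si si).
Qed.

Lemma modulus_test M e phi : 0 < e -> test_function M phi ->
  real_test M (modulus e phi).
Proof.
move=> e0 tphi; have sN := normc_sqr_smooth tphi.
split.
  apply: (@smoothD _ _ (Num.sqrt \o (fun x => normc (phi x) ^+ 2 + e ^+ 2))
     (cst (- e))); last exact: smooth_cst.
  apply: smooth_sqrt => [|x].
    exact: (smoothD sN (smooth_cst (e ^+ 2))).
  by rewrite ltr_wpDl ?sqr_ge0// exprn_gt0.
have [_ _ [C [cC CM pC]]] := tphi; exists C; split=> // x /pC px.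
rewrite /modulus px ComplexField.Normc.normc0 expr0n add0r sqrtr_sqr.
rewrite ger0_norm ?subrr//.
exact: ltW.
Qed.

(** With [phi = r + i s], the derivative of the modulus is
    [(r r' + s s') / sqrt (r^2 + s^2 + e^2)], and the Cauchy-Schwarz inequality
    bounds the numerator. *)
Lemma partial_modulus_le M e phi i x : 0 < e -> test_function M phi ->
  partial i (modulus e phi) x ^+ 2 <= normc (cpartial i phi x) ^+ 2.
Proof.
move=> e0 tphi; have [sr si _] := tphi.
set r : V -> R := @complex.Re R \o phi in sr *.
set s : V -> R := @complex.Im R \o phi in si *.
rewrite (_ : ComplexField.Normc.normc (cpartial i phi x) ^+ 2 =
  partial i r x ^+ 2 + partial i s x ^+ 2); last by rewrite normc_sqr.
pose Q : V -> R := ((r \* r) \+ (s \* s)) \+ cst (e ^+ 2).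
have sQ : smooth_on setT Q.
  apply: smoothD; last exact: smooth_cst.
  by apply: smoothD; exact: smoothM.
have Q0 y : 0 < Q y.
  by rewrite /Q /= ltr_wpDl ?exprn_gt0// addr_ge0// -expr2 sqr_ge0.
have mE : modulus e phi = (Num.sqrt \o Q) \+ cst (- e).
  apply/funext => y; rewrite /modulus /Q /=; congr (Num.sqrt _ - _).
  by rewrite normc_sqr -!expr2.
rewrite mE partialD; [|exact: smooth_sqrt|exact: smooth_cst].
rewrite partial_cst (partialE (fun y => is_derive_sqrt_comp i sQ (Q0 y))) /= addr0.
have dQ : partial i Q x = 2 * (r x * partial i r x + s x * partial i s x).
  rewrite /Q partialD; [|by apply: smoothD; exact: smoothM|exact: smooth_cst].
  rewrite partial_cst partialD; [|exact: smoothM|exact: smoothM].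
  by rewrite !partialM//=; ring.
rewrite dQ; set a := partial i r x; set b := partial i s x.
rewrite -mulf_div divff// mul1r expr_div_n sqr_sqrtr ?(ltW (Q0 x))//.
rewrite ler_pdivrMr// /Q /=.
have h1 : 0 <= e ^+ 2 * (a ^+ 2 + b ^+ 2).
  by apply: mulr_ge0; [exact: sqr_ge0|apply: addr_ge0; exact: sqr_ge0].
have := sqr_ge0 (r x * b - s x * a); rewrite !expr2 in h1 *; lra.
Qed.

(** The triangle inequality for squares: [d] measures the loss on the main term,
    which can be made small at the expense of the error term. *)
Lemma normc_sqr_le_eps (d : R) (z w : R[i]) : 0 < d ->
  normc w ^+ 2 <= (1 + d) * normc z ^+ 2 + (1 + d^-1) * normc (z - w) ^+ 2.
Proof.
move=> d0; rewrite !normc_sqr; case: z => a b; case: w => a' b' /=.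
have H (x y : R) : y ^+ 2 <= (1 + d) * x ^+ 2 + (1 + d^-1) * (x - y) ^+ 2.
  rewrite -subr_ge0.
  rewrite (_ : _ - _ = d^-1 * (d * x + (x - y)) ^+ 2); last first.
    by field; rewrite gt_eqF.
  by rewrite mulr_ge0 ?sqr_ge0// invr_ge0 ltW.
have := H a a'; have := H b b'; lra.
Qed.

End modulus.

(** * First variation of the energy *)
Section energy_expansion.
Context {R : realType} {n : nat}.
Local Notation V := 'rV[R]_n.
Local Notation mu := (@lebesgue_rV R n).
Implicit Types (a psi : V -> R).

Lemma Rintegral_sum_partial (w : 'I_n -> V -> R) :
  (forall i, smooth_on setT (w i)) -> (forall i, vanishes_far (w i)) ->
  \int[mu]_x (\sum_(i < n) partial i (w i) x) = 0.
Proof.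
move=> sw vw; rewrite /Rintegral.
under eq_integral do rewrite -sumEFin.
rewrite integral_sum//; last first.
  move=> i; apply: integrable_supp; last exact: vanishes_far_partial.
  by apply: smooth_continuous; exact: smooth_partial.
by rewrite big1// => i _; exact: integral_partial.
Qed.

(** The cross term [grad a . grad psi] is [- a * Laplacian psi] up to the
    divergence of [a * grad psi], whose integral vanishes; no derivative of [a]
    is left, so the limit of [a] can be taken almost everywhere. *)
Lemma energyD lambda t a psi : smooth_on setT a -> vanishes_far a ->
  smooth_on setT psi -> vanishes_far psi ->
  energy lambda (a \+ (fun x => t * psi x)) = energy lambda a +
   2 * t * \int[mu]_x (a x * schrodinger lambda psi x) + t ^+ 2 * energy lambda psi.
Proof.
move=> sa va sp vp.
have sL : smooth_on setT (schrodinger lambda psi).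
  exact: smooth_schrodinger.
have iaL : mu.-integrable setT (fun x => (a x * schrodinger lambda psi x)%:E).
  apply: (integrable_supp (f := a \* schrodinger lambda psi)).
    by apply: smooth_continuous; exact: smoothM.
  exact: vanishes_farMl.
pose w i : V -> R := a \* partial i psi.
have sw i : smooth_on setT (w i) := smoothM sa (smooth_partial i sp).
have vw i : vanishes_far (w i) by exact: vanishes_farMl.
have idw : mu.-integrable setT (fun x => (\sum_(i < n) partial i (w i) x)%:E).
  apply: (integrable_supp (f := fun x => \sum_(i < n) partial i (w i) x)).
    exact: (smooth_continuous (smooth_sum _ (fun i => smooth_partial i (sw i)))).
  by apply: vanishes_far_sum => i; exact: vanishes_far_partial.
have ia := energy_density_integrable lambda sa va.
have ip := energy_density_integrable lambda sp vp.
have dE x : energy_density lambda (a \+ (fun x => t * psi x)) x =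
    energy_density lambda a x +
    2 * t * (a x * schrodinger lambda psi x + \sum_(i < n) partial i (w i) x) +
    t ^+ 2 * energy_density lambda psi x.
  rewrite /energy_density /schrodinger.
  have e1 : \sum_(i < n) partial i (a \+ (fun x => t * psi x)) x ^+ 2 =
    \sum_(i < n) partial i a x ^+ 2
     + 2 * t * \sum_(i < n) (partial i a x * partial i psi x)
     + t ^+ 2 * \sum_(i < n) partial i psi x ^+ 2.
    rewrite !mulr_sumr -!big_split; apply: eq_bigr => i _ /=.
    rewrite partialD; [|by []|exact: smoothZ].
    by rewrite partialZ//=; ring.
  have e2 : \sum_(i < n) partial i (w i) x =
     a x * \sum_(i < n) partial i (partial i psi) x +
     \sum_(i < n) (partial i a x * partial i psi x).
    rewrite mulr_sumr -big_split; apply: eq_bigr => i _ /=.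
    rewrite (partialM i sa (smooth_partial i sp)) /=.
    by rewrite [X in _ + X]mulrC.
  by rewrite e1 e2 /=; ring.
rewrite /energy; under eq_Rintegral do rewrite dE.
have iB : mu.-integrable setT (fun x => (2 * t *
    (a x * schrodinger lambda psi x + \sum_(i < n) partial i (w i) x))%:E).
  exact: (integrableZl measurableT (2 * t) (integrableD measurableT iaL idw)).
have iC : mu.-integrable setT (fun x => (t ^+ 2 * energy_density lambda psi x)%:E).
  exact: (integrableZl measurableT (t ^+ 2) ip).
have iAB := integrableD measurableT ia iB.
rewrite RintegralD// RintegralD// RintegralZl//; last first.
  exact: (integrableD measurableT iaL idw).
rewrite (@RintegralD _ _ _ mu setT (fun x => a x * schrodinger lambda psi x))//.
by rewrite (Rintegral_sum_partial sw vw) addr0 RintegralZl.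
Qed.

End energy_expansion.

(** * Passing to the limit almost everywhere *)
Section limits.
Context {R : realType}.

Lemma cvg_powR (q w : R) (a : nat -> R) : 0 < q -> 0 <= w ->
  (forall k, 0 <= a k) -> a @ \oo --> w -> a k `^ q @[k --> \oo] --> w `^ q.
Proof.
move=> q0 w0 a0 aw.
have [w1|w1] := ltP 0 w.
  have dq : derivable (fun x : R => x `^ q) w 1.
    by apply: derivable_powR; rewrite in_itv /= w1.
  have cq : {for w, continuous (fun x : R => x `^ q)}.
    by apply/differentiable_continuous/derivable1_diffP.
  exact: (cvg_comp _ _ aw cq).
have -> : w = 0 by apply/eqP; rewrite eq_le w0 w1.
have {}aw : a @ \oo --> (0 : R).
  by rewrite (_ : 0 = w)//; apply/eqP; rewrite eq_le w0 w1.
rewrite powR0 ?gt_eqF//; apply/cvgrPdist_le => e e0.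
have e1 : 0 < e `^ q^-1 by exact: powR_gt0.
move/cvgrPdist_le : aw => /(_ _ e1); apply: filterS => k.
rewrite !sub0r !normrN !ger0_norm ?powR_ge0// => ak.
rewrite -[leRHS]powRr1 ?(ltW e0)// -(@mulVf _ q) ?gt_eqF// powRrM.
by rewrite ge0_ler_powR ?nnegrE ?powR_ge0// ltW.
Qed.

Lemma limn_einf_gt (u : nat -> \bar R) (c : \bar R) : (c < limn_einf u)%E ->
  exists N, forall k, (N <= k)%N -> (c < u k)%E.
Proof.
rewrite limn_einf_lim => cu.
have cv : cvgn (einfs u).
  exact: is_cvg_einfs.
have [N cN] : exists N, (c < einfs u N)%E.
  apply/not_existsP => H; move: cu; apply/negP; rewrite -leNgt.
  by apply: lime_le => //; apply: nearW => k; rewrite leNgt; exact/negP.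
exists N => k Nk; apply: (lt_le_trans cN); apply: ereal_inf_lbound.
by exists k.
Qed.

Context d (T : measurableType d) (mu : {measure set T -> \bar R}) (D : set T).
Hypothesis mD : measurable D.

(** Fatou's lemma in the form of an eventual strict lower bound. *)
Lemma fatou_lower (f : nat -> T -> \bar R) (g : T -> \bar R) (c : \bar R) :
  (forall k, measurable_fun D (f k)) -> (forall k x, D x -> 0 <= f k x)%E ->
  measurable_fun D g -> (forall x, D x -> 0 <= g x)%E ->
  {ae mu, forall x, D x -> f k x @[k --> \oo] --> g x} ->
  (c < \int[mu]_(x in D) g x)%E ->
  exists N, forall k, (N <= k)%N -> (c < \int[mu]_(x in D) f k x)%E.
Proof.
move=> mf f0 mg g0 fg cg; apply: limn_einf_gt.
apply: (lt_le_trans cg); apply: le_trans (fatou mu mD mf f0).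
apply: ae_ge0_le_integral => //.
- move=> x Dx; rewrite limn_einf_lim; apply: lime_ge; first exact: is_cvg_einfs.
  by apply: nearW => k; apply: le_ereal_inf_tmp => _ [m _ <-]; exact: f0.
- rewrite /limn_einf; apply: measurableT_comp => //.
  by apply: measurable_fun_limn_esup => k; exact: measurableT_comp.
- apply: filterS fg => x H Dx.
  by have := H Dx => /cvg_limn_einf_sup[-> _].
Qed.

(** The sum of the [f k] is integrable, hence finite almost everywhere, and the
    terms of a convergent series tend to 0. *)
Lemma summable_ae_cvg0 (f : nat -> T -> R) :
  (forall k, measurable_fun D (f k)) -> (forall k x, 0 <= f k x) ->
  (forall k, \int[mu]_(x in D) (f k x)%:E <= (1 / (2 ^ k.+1)%:R)%:E)%E ->
  {ae mu, forall x, D x -> f k x @[k --> \oo] --> (0 : R)}.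
Proof.
move=> mf f0 fle.
have mEf k : measurable_fun D (fun x => (f k x)%:E) by exact/measurable_EFinP.
have f0' k x : D x -> (0 <= (f k x)%:E)%E by rewrite lee_fin.
pose g x := (\sum_(k <oo) (f k x)%:E)%E.
have g0 x : (0 <= g x)%E by apply: nneseries_ge0 => k _ _; rewrite lee_fin.
have ig : mu.-integrable D g.
  apply/integrableP; split.
    by apply: ge0_emeasurable_sum => // k x Dx _; exact: f0'.
  rewrite (eq_integral g); last by move=> x _; rewrite gee0_abs.
  rewrite integral_nneseries//.
  apply: (@le_lt_trans _ _ 1%E); last exact: ltry.
  apply: le_trans (epsilon_trick0 xpredT (@ler01 R)).
  by apply: lee_nneseries => // k _ _; apply: integral_ge0 => x; exact: f0'.
apply: filterS (integrable_ae mD ig) => x H Dx.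
have gx : (g x < +oo)%E by have := H Dx; rewrite ge0_fin_numE.
have := nneseries_tail_cvg gx (fun k _ => f0' k x Dx).
move=> H0.
have : (fun k => (f k x)%:E) @ \oo --> 0%E.
  apply: (squeeze_cvge _ (cvg_cst 0%E) H0).
  apply: nearW => k; rewrite f0'//=.
  rewrite (nneseries_split k 1); last by move=> j _; exact: f0'.
  rewrite addn1 big_nat1 leeDl// nneseries_ge0// => j _ _; exact: f0'.
by move/fine_cvgP => [].
Qed.

End limits.

(** * Energy of the smoothed modulus *)

Section energy_of_modulus.
Local Notation normc := ComplexField.Normc.normc.
Context {R : realType} {n : nat}.
Local Notation V := 'rV[R]_n.
Local Notation mu := (@lebesgue_rV R n).

Lemma ge0_integral_le_lin d (T : measurableType d) (m : {measure set T -> \bar R})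
    (M : set T) (f h k : T -> R) (a b : R) : measurable M ->
  measurable_fun M f -> measurable_fun M h -> measurable_fun M k ->
  (forall x, 0 <= f x) -> (forall x, 0 <= h x) -> (forall x, 0 <= k x) ->
  0 <= a -> 0 <= b -> (forall x, f x <= a * h x + b * k x) ->
  (\int[m]_(x in M) (f x)%:E <=
   a%:E * \int[m]_(x in M) (h x)%:E + b%:E * \int[m]_(x in M) (k x)%:E)%E.
Proof.
move=> mM mf mh mk f0 h0 k0 a0 b0 fhk.
have mah : measurable_fun M (fun x => (a%:E * (h x)%:E)%E).
  by apply/measurable_EFinP; exact: measurable_funM.
have mbk : measurable_fun M (fun x => (b%:E * (k x)%:E)%E).
  by apply/measurable_EFinP; exact: measurable_funM.
apply: (@le_trans _ _ (\int[m]_(x in M) (a%:E * (h x)%:E + b%:E * (k x)%:E))%E).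
  apply: ge0_le_integral => //.
  - by move=> x _; rewrite lee_fin.
  - exact/measurable_EFinP.
  - exact: emeasurable_funD.
  - by move=> x _; rewrite -!EFinM -EFinD lee_fin.
rewrite ge0_integralD//; last 2 first.
- by move=> x _; rewrite -EFinM lee_fin mulr_ge0.
- by move=> x _; rewrite -EFinM lee_fin mulr_ge0.
rewrite !ge0_integralZl//.
- exact/measurable_EFinP.
- by move=> x _; rewrite lee_fin.
- exact/measurable_EFinP.
- by move=> x _; rewrite lee_fin.
Qed.

Lemma measurable_normc_sqrB M (w phi : V -> R[i]) : L2 M w ->
  measurable_fun M (@complex.Re R \o phi) -> measurable_fun M (@complex.Im R \o phi) ->
  measurable_fun M (fun x => normc ((w \- phi) x) ^+ 2).
Proof.
move=> [mr mi _] pr pi; apply: measurable_normc_sqr.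
- have := measurable_funB mr pr.
  by congr (measurable_fun _ _); apply/funext => x /=; case: (w x); case: (phi x).
- have := measurable_funB mi pi.
  by congr (measurable_fun _ _); apply/funext => x /=; case: (w x); case: (phi x).
Qed.

Lemma measurable_normc M (w : V -> R[i]) : L2 M w ->
  measurable_fun M (fun x => normc (w x)).
Proof.
move=> [mr mi _]; have m2 := measurable_normc_sqr mr mi.
have ms : measurable_fun [set: R] (@Num.sqrt R).
  by apply: continuous_measurable_fun; exact: sqrt_continuous.
have := measurableT_comp ms m2; congr (measurable_fun _ _).
by apply/funext => x /=; rewrite sqrtr_sqr ger0_norm// normc_ge0.
Qed.

(** The gradient and the value of the modulus are bounded by those of [phi],
    which are compared with [g] and [u] by [normc_sqr_le_eps].  The total error
    [eta] controls each of the two parts of the distance, whence the factor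
    [1 + lambda]. *)
Lemma energy_modulus_le (M : set V) (u phi : V -> R[i])
    (g : 'I_n -> V -> R[i]) (lambda d e eta E : R) : open M -> 0 <= lambda ->
  0 < d -> 0 < e -> L2 M u -> (forall i, L2 M (g i)) -> test_function M phi ->
  (grad_norm_sqr M g + lambda%:E * L2norm_sqr M u)%E = E%:E ->
  (L2norm_sqr M (u \- phi)%R
     + grad_norm_sqr M (fun i => g i \- cpartial i phi)%R < eta%:E)%E ->
  energy lambda (modulus e phi) <=
    (1 + d) * E + (1 + d^-1) * (1 + lambda) * eta.
Proof.
move=> oM l0 d0 e0 L2u L2g tphi FE Xeta.
have mM := open_measurable_rV oM.
have ta := modulus_test e0 tphi.
have [sr si _] := tphi.
have c0 : 0 <= 1 + d^-1 by rewrite addr_ge0// invr_ge0 ltW.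
have d10 : 0 <= 1 + d by rewrite addr_ge0// ltW.
have dr i : real_test M (partial i (@complex.Re R \o phi)).
  by apply: real_test_partial; exact: test_function_Re.
have di i : real_test M (partial i (@complex.Im R \o phi)).
  by apply: real_test_partial; exact: test_function_Im.
have [mr mi _] := L2u.
have hA : (\int[mu]_(x in M) (\sum_(i < n) partial i (modulus e phi) x ^+ 2)%:E <=
    (1 + d)%:E * grad_norm_sqr M g +
    (1 + d^-1)%:E * grad_norm_sqr M (fun i => g i \- cpartial i phi)%R)%E.
  apply: ge0_integral_le_lin => //.
  - apply: measurable_sum => i; apply: measurable_funX.
    by apply: measurable_test; exact: real_test_partial.
  - apply: measurable_sum => i; have [gr gi _] := L2g i.
    exact: measurable_normc_sqr.
  - apply: measurable_sum => i; apply: measurable_normc_sqrB => //.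
      exact: measurable_test (dr i).
    exact: measurable_test (di i).
  - by move=> x; apply: sumr_ge0 => i _; exact: sqr_ge0.
  - by move=> x; apply: sumr_ge0 => i _; exact: sqr_ge0.
  - by move=> x; apply: sumr_ge0 => i _; exact: sqr_ge0.
  - move=> x; rewrite !mulr_sumr -big_split; apply: ler_sum => i _ /=.
    apply: le_trans (partial_modulus_le i x e0 tphi) _.
    exact: normc_sqr_le_eps.
have hB : (L2norm_sqr M (cplx (modulus e phi)) <=
    (1 + d)%:E * L2norm_sqr M u + (1 + d^-1)%:E * L2norm_sqr M (u \- phi)%R)%E.
  apply: ge0_integral_le_lin => //.
  - by have [? ? _] := L2_cplx oM ta; exact: measurable_normc_sqr.
  - exact: measurable_normc_sqr.
  - apply: measurable_normc_sqrB => //.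
      exact: measurable_test (test_function_Re tphi).
    exact: measurable_test (test_function_Im tphi).
  - by move=> x; exact: sqr_ge0.
  - by move=> x; exact: sqr_ge0.
  - by move=> x; exact: sqr_ge0.
  - move=> x; apply: le_trans (normc_sqr_le_eps (u x) (phi x) d0).
    rewrite normc_cplx; have [h1 h2 _] := modulus_bounds phi x e0.
    by rewrite ger0_norm// ler_sqr ?nnegrE ?normc_ge0.
have := F_cplx oM l0 ta; rewrite /F_ grad_norm_nabla_cplx//.
have A0 : (0 <= \int[mu]_(x in M)
    (\sum_(i < n) partial i (modulus e phi) x ^+ 2)%:E)%E.
  by apply: integral_ge0 => x _; rewrite lee_fin sumr_ge0// => i _; exact: sqr_ge0.
have B0 w : (0 <= L2norm_sqr M w)%E.
  by apply: integral_ge0 => x _; rewrite lee_fin sqr_ge0.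
have G0 w : (0 <= grad_norm_sqr M w)%E.
  by apply: integral_ge0 => x _; rewrite lee_fin sumr_ge0// => i _; exact: sqr_ge0.
have Bc : (L2norm_sqr M (cplx (modulus e phi)) < +oo)%E by have [] := L2_cplx oM ta.
have Bu : (L2norm_sqr M u < +oo)%E by case: L2u.
have fB : L2norm_sqr M (cplx (modulus e phi)) \is a fin_num by rewrite ge0_fin_numE.
have fU : L2norm_sqr M u \is a fin_num by rewrite ge0_fin_numE.
have fG : grad_norm_sqr M g \is a fin_num.
  have : (grad_norm_sqr M g + lambda%:E * L2norm_sqr M u)%E \is a fin_num.
    by rewrite FE.
  by rewrite fin_numD => /andP[].
have /andP[fX1 fX2] : (L2norm_sqr M (u \- phi)%R \is a fin_num) &&
    (grad_norm_sqr M (fun i => g i \- cpartial i phi)%R \is a fin_num).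
  rewrite -fin_numD ge0_fin_numE; first exact: lt_trans Xeta (ltry _).
  exact: adde_ge0.
move: hA hB Xeta FE (G0 g) (B0 u) (B0 (u \- phi))
  (G0 (fun i => g i \- cpartial i phi)).
rewrite -(fineK fB) -(fineK fU) -(fineK fG) -(fineK fX1) -(fineK fX2).
move: (fine _) (fine _) (fine _) (fine _) (fine _) => X1 X2 U G B.
rewrite -!EFinM -!EFinD => hA.
have fA : (\int[mu]_(x in M) (\sum_(i < n) partial i (modulus e phi) x ^+ 2)%:E)%E
    \is a fin_num.
  by rewrite ge0_fin_numE// (le_lt_trans hA)// ltry.
move: hA; rewrite -(fineK fA); move: (fine _) => A.
rewrite !lee_fin lte_fin => hA hB Xeta [FE] G1 U1 X10 X20.
rewrite -EFinD => -[<-]; rewrite -FE.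
move: (1 + d^-1) c0 hA hB => c c0 hA hB.
have hlB := ler_wpM2l l0 hB.
have h1 : 0 <= lambda * G by exact: mulr_ge0.
have h3 : G + lambda * X1 <= (1 + lambda) * (X1 + G) by lra.
have l10 : 0 <= 1 + lambda by rewrite addr_ge0.
have h4 := ler_wpM2l l10 (ltW Xeta).
have := ler_wpM2l c0 (le_trans h3 h4); lra.
Qed.

(** Letting [s] tend to 1 and [d], [eta] to 0 would give [e <= e - gam]. *)
Lemma squeeze_contradiction (e gam : R) : 0 <= e -> 0 < gam ->
  (forall s d eta : R, 0 < s < 1 -> 0 < d -> 0 < eta ->
    s ^+ 2 * e <= (1 + d) * e + eta - gam) -> False.
Proof.
move=> e0 g0 H.
(* With [s = 1 - tau] the left side loses at most [2 tau e < gam / 4], while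
   [d e < gam / 4] and [eta = gam / 4]. *)
pose tau := gam / (8 * (e + 1) + gam).
have D0 : 0 < 8 * (e + 1) + gam by lra.
have t0 : 0 < tau by rewrite divr_gt0.
have tD : tau * (8 * (e + 1) + gam) = gam by rewrite divfK// gt_eqF.
have t1 : tau < 1 by rewrite ltr_pdivrMr//; lra.
pose d := gam / (4 * (e + 1)).
have e10 : 0 < 4 * (e + 1) by lra.
have d0 : 0 < d by rewrite divr_gt0.
have dD : d * (4 * (e + 1)) = gam by rewrite divfK// gt_eqF.
have s01 : 0 < 1 - tau < 1 by apply/andP; split; lra.
have g40 : 0 < gam / 4 by rewrite divr_gt0.
have := H _ _ _ s01 d0 g40.
have h1 : 0 <= tau * e by rewrite mulr_ge0// ltW.
have h2 : 0 < tau * gam by rewrite mulr_gt0.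
have h3 : 0 <= tau ^+ 2 * e by rewrite mulr_ge0// sqr_ge0.
have h4 : (1 - tau) ^+ 2 * e = e - 2 * (tau * e) + tau ^+ 2 * e by ring.
have tD' : 8 * (tau * e) + 8 * tau + tau * gam = gam by rewrite -[RHS]tD; ring.
have dD' : 4 * (d * e) + 4 * d = gam by rewrite -[RHS]dD; ring.
rewrite h4; nra.
Qed.

End energy_of_modulus.

(** * A minimizer is a supersolution, hence zero *)
Section nonexistence.
Local Notation normc := ComplexField.Normc.normc.
Context {R : realType} {n : nat}.
Local Notation V := 'rV[R]_n.
Local Notation mu := (@lebesgue_rV R n).

Lemma modulus_cvg (w : R[i]) (phi : nat -> V -> R[i]) (e : nat -> R) (x : V) :
  (forall k, 0 < e k) -> e @ \oo --> (0 : R) ->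
  normc (w - phi k x) ^+ 2 @[k --> \oo] --> (0 : R) ->
  modulus (e k) (phi k) x @[k --> \oo] --> normc w.
Proof.
move=> e0 ecvg h2.
have h : normc (w - phi k x) @[k --> \oo] --> (0 : R).
  rewrite (_ : (fun k => _) = Num.sqrt \o (fun k => normc (w - phi k x) ^+ 2)).
    by have := cvg_comp _ _ h2 (@sqrt_continuous R 0); rewrite sqrtr0.
  by apply/funext => k /=; rewrite sqrtr_sqr ger0_norm// normc_ge0.
have hs : e k + normc (w - phi k x) @[k --> \oo] --> (0 : R).
  by rewrite -[X in _ --> X](addr0 0); apply: cvgD.
apply/cvgrPdist_le => d d0.
move/cvgrPdist_le : hs => /(_ _ d0); apply: filterS => k.
rewrite sub0r normrN ger0_norm; last by rewrite addr_ge0 ?normc_ge0// ltW.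
move=> dk; apply: le_trans dk.
have [m0 m1 m2] := modulus_bounds (phi k) x (e0 k).
have tri (x' y' : R[i]) : normc (x' + y') <= normc x' + normc y'.
  exact: le_normcD.
have tN : normc (phi k x - w) = normc (w - phi k x).
  by rewrite -opprB; exact: normcN.
have t1 := tri (phi k x) (w - phi k x); rewrite addrC subrK in t1.
have t2 := tri w (phi k x - w); rewrite addrC subrK tN in t2.
by rewrite ler_norml; apply/andP; split; have := e0 k; lra.
Qed.

Variables (K : set V) (z : V) (rho rK : R) (i0 : 'I_n).
Hypotheses (cK : closed K) (Kr : forall x, K x -> `|x| <= rK).
Hypotheses (rho0 : 0 < rho) (Kz : forall x, ~ K x -> rho <= sqdist z x).
Variables (lambda beta p : R).
Hypotheses (l0 : 0 < lambda) (b0 : 0 < beta) (p0 : 0 < p).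
Variable u : V -> R[i].
Let M := ~` K.
Hypotheses (Hu : H10 M u) (Ju : J_ p M u = beta%:E).
Variable E : R.
Hypotheses (Fu : F_ lambda M u = E%:E) (IE : I_ lambda p beta M = E%:E).

Let oM : open M := closed_openC cK.
Let mM : measurable M := open_measurable_rV oM.
Let L2u : L2 M u := Hu.1.1.
Let eps k : R := k.+1%:R^-1.
Let eps0 k : 0 < eps k. Proof. by rewrite invr_gt0. Qed.

(** The squared distances of [phi k] to [u] are chosen to be at most
    [2 ^ - k.+1]; being summable, they give convergence almost everywhere of the
    whole sequence. *)
Lemma modulus_sequence : exists phi : nat -> V -> R[i],
  [/\ forall k, test_function M (phi k),
      forall k (d : R), 0 < d -> energy lambda (modulus (eps k) (phi k)) <=
        (1 + d) * E + (1 + d^-1) * (1 + lambda) * (1 / (2 ^ k.+1)%:R) &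
      {ae mu, forall x, M x ->
        modulus (eps k) (phi k) x @[k --> \oo] --> normc (u x)}].
Proof.
have e0 k : 0 < 1 / (2 ^ k.+1)%:R :> R.
  by rewrite divr_gt0// ltr0n expn_gt0.
have [phi phiP] := choice (fun k => let: ex_intro2 f tf df := Hu.2 _ (e0 k) in
  ex_intro (fun f => test_function M f /\ (L2norm_sqr M (u \- f)%R
     + grad_norm_sqr M (fun i => nabla M u i \- cpartial i f)%R
       < (1 / (2 ^ k.+1)%:R)%:E)%E)
    f (conj tf df)).
have tphi k : test_function M (phi k) by have [] := phiP k.
exists phi; split=> //.
- move=> k d d0; have [_ Xk] := phiP k.
  apply: (energy_modulus_le oM (ltW l0) d0 (eps0 k) L2u _ (tphi k) Fu Xk).
  by move=> i; have [] := nablaP Hu.1 i.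
- have : {ae mu, forall x, M x ->
      normc ((u \- phi k) x) ^+ 2 @[k --> \oo] --> (0 : R)}.
    apply: (summable_ae_cvg0 mM).
    + move=> k; apply: measurable_normc_sqrB => //.
        exact: measurable_test (test_function_Re (tphi k)).
      exact: measurable_test (test_function_Im (tphi k)).
    + by move=> k x; exact: sqr_ge0.
    + move=> k; apply: le_trans (ltW (phiP k).2).
      apply: leeDl; apply: integral_ge0 => x _.
      by rewrite lee_fin sumr_ge0// => i _; exact: sqr_ge0.
  apply: filterS => x H Mx; apply: modulus_cvg => //; first exact: cvg_harmonic.
  exact: H.
Qed.

(** Let [D] be the integral and suppose that it is positive.  Adding [t psi] to
    [a_k] changes the energy by about [- 2 t D + t^2 energy psi], negative for
    small [t], and does not decrease the mass.  For large [k] the energy of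
    [a_k] is almost [E] and its mass almost [beta], so the sum violates
    [energy_lower_bound]. *)
Lemma minimizer_supersolution (psi : V -> R) : smooth_on setT psi ->
  vanishes_far psi -> (forall x, 0 <= psi x) ->
  (forall x, M x -> schrodinger lambda psi x <= 0) ->
  (\int[mu]_(x in M) (normc (u x) * - schrodinger lambda psi x)%:E = 0)%E.
Proof.
move=> sp vp psi0 Lp.
have [phi [tphi phiE phicvg]] := modulus_sequence.
pose a k := modulus (eps k) (phi k).
have ta k : real_test M (a k) by exact: modulus_test.
have a0 k x : 0 <= a k x by have [] := modulus_bounds (phi k) x (eps0 k).
have N0 x : 0 <= normc (u x) by exact: normc_ge0.
have mN := measurable_normc L2u.
set L := schrodinger lambda psi in Lp *.
have sL : smooth_on setT L.
  exact: smooth_schrodinger.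
have mL : measurable_fun M L.
  apply: measurable_funTS; apply: continuous_measurable_rV.
  exact: smooth_continuous.
set D := (\int[mu]_(x in M) _)%E.
have fD0 x : M x -> (0 <= (normc (u x) * - L x)%:E)%E.
  by move=> Mx; rewrite lee_fin mulr_ge0// oppr_ge0 Lp.
have D0 : (0 <= D)%E by exact: integral_ge0.
apply/eqP; rewrite eq_le D0 andbT leNgt; apply/negP => Dpos.
(* [D] might be infinite; any positive real below it will do. *)
have [d d0 dD] : exists2 d : R, 0 < d & (d%:E < D)%E.
  move: Dpos; case: (D) => [r| |//]; last by exists 1; rewrite ?ltry.
  rewrite lte_fin => r0; exists (r / 2); first by rewrite divr_gt0.
  by rewrite lte_fin; lra.
have [N1 HN1] : exists N, forall k, (N <= k)%N ->
    (d%:E < \int[mu]_(x in M) (a k x * - L x)%:E)%E.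
  apply: (fatou_lower mM) dD => //.
  - move=> k; apply/measurable_EFinP; apply: measurable_funM.
      exact: measurable_test.
    by apply: measurable_funN.
  - by move=> k x Mx; rewrite lee_fin mulr_ge0// oppr_ge0 Lp.
  - apply/measurable_EFinP; apply: measurable_funM => //.
    by apply: measurable_funN.
  - apply: filterS phicvg => x H Mx; apply/fine_cvgP; split; first exact: nearW.
    by apply: cvgMl; exact: H.
have cE k : \int[mu]_x (a k x * L x) < - d \/ (k < N1)%N.
  have [kN|kN] := leqP N1 k; last by right.
  left; have := HN1 k kN; rewrite integral_supp; last first.
    by move=> x Mx; rewrite (real_test_out (ta k) Mx) mul0r.
  have ikL : mu.-integrable setT (fun x => (a k x * - L x)%:E).
    apply: (integrable_supp (f := a k \* (\- L))).
      apply: smooth_continuous; apply: smoothM; first by case: (ta k).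
      rewrite (_ : (\- L) = (fun x => -1 * L x)); first exact: smoothZ.
      by apply/funext => x /=; rewrite mulN1r.
    by apply: vanishes_farMl; exact: real_test_vanishes (ta k).
  rewrite -(fineK (integrable_fin_num measurableT ikL)) lte_fin.
  have -> : (fun x => a k x * L x) = (fun x => -1 * (a k x * - L x)).
    by apply/funext => x; ring.
  by rewrite RintegralZl// mulN1r ltrN2.
pose Ep := energy lambda psi.
have Ep0 : 0 <= Ep by apply: energy_ge0; exact: ltW.
(* Minimizing [- 2 t d + t^2 Ep], up to the 1 that avoids a division by 0;
   the gain is then at least [t d]. *)
pose t := d / (Ep + 1).
have Ep1 : 0 < Ep + 1 by lra.
have t0 : 0 < t by rewrite divr_gt0.
have tE : t * Ep + t = d by rewrite -[RHS](divfK (lt0r_neq0 Ep1)) -/t; ring.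
have E0 : 0 <= E.
  rewrite -lee_fin -Fu; apply: adde_ge0.
    apply: integral_ge0 => x _.
    by rewrite lee_fin sumr_ge0// => i _; exact: sqr_ge0.
  apply: mule_ge0; first by rewrite lee_fin ltW.
  by apply: integral_ge0 => x _; rewrite lee_fin sqr_ge0.
have gam0 : 0 < t * d by exact: mulr_gt0.
apply: (squeeze_contradiction E0 gam0) => s del eta /andP[s0 s1] del0 eta0.
have p10 : 0 < p + 1 by rewrite addr_gt0.
have [N2 HN2] : exists N, forall k, (N <= k)%N ->
    ((beta * s `^ (p + 1))%:E < J_ p M (cplx (a k)))%E.
  apply: (fatou_lower mM (g := fun x => (normc (u x) `^ (p + 1))%:E)).
  - move=> k; apply/measurable_EFinP.
    under eq_fun do rewrite normc_cplx.
    apply: measurable_funTS; apply: measurable_norm_powR.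
    exact: real_test_continuous (ta k).
  - by move=> k x _; rewrite lee_fin powR_ge0.
  - apply/measurable_EFinP.
    apply: (@measurableT_comp _ _ _ _ _ _ (fun y : R => y `^ (p + 1))) mN.
    exact: measurable_powR.
  - by move=> x _; rewrite lee_fin powR_ge0.
  - apply: filterS phicvg => x H Mx; apply/fine_cvgP; split; first exact: nearW.
    apply: cvg_powR => //; first by move=> k; exact: normc_ge0.
    under eq_fun do rewrite normc_cplx ger0_norm//.
    exact: H.
  - rewrite -/(J_ p M u) Ju lte_fin gtr_pMr//.
    have one : 1 = 1 `^ (p + 1) :> R by rewrite powR1.
    by rewrite [ltRHS]one gt0_ltr_powR ?nnegrE ?ltW.
have [N3 HN3] : exists N, forall k, (N <= k)%N ->
   (1 + del^-1) * (1 + lambda) * (1 / (2 ^ k.+1)%:R) <= eta.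
  set c := (1 + del^-1) * (1 + lambda).
  exists (Num.truncn (c / eta)) => k Nk.
  have k2 : 0 < (2 ^ k.+1)%:R :> R by rewrite ltr0n expn_gt0.
  rewrite mulrA mulr1 ler_pdivrMr// mulrC -ler_pdivrMr//.
  apply: le_trans (ltW (truncnS_gt _)) _.
  by rewrite ler_nat (leq_trans _ (ltnW (ltn_expl k.+1 (ltnSn 1)))).
pose k := maxn N1 (maxn N2 N3).
have k1 : (N1 <= k)%N by rewrite leq_maxl.
have k2 : (N2 <= k)%N by rewrite !leq_max leqnn orbT.
have k3 : (N3 <= k)%N by rewrite !leq_max leqnn !orbT.
pose v : V -> R := a k \+ (fun x => t * psi x).
have sv : smooth_on setT v by apply: smoothD; [case: (ta k)|exact: smoothZ].
have va : vanishes_far (a k) by exact: real_test_vanishes (ta k).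
have vv : vanishes_far v.
  by apply: vanishes_farD => //; exact: (vanishes_farMr (cst t) vp).
have mv : beta * s `^ (p + 1) <= mass p v.
  have := HN2 k k2; rewrite (J_cplx p0 (ta k)) lte_fin => /ltW /le_trans; apply.
  apply: le_Rintegral => //.
  - by apply: mass_integrable => //; exact: real_test_continuous (ta k).
  - by apply: mass_integrable => //; exact: smooth_continuous.
  - move=> x _; rewrite ge0_ler_powR ?nnegrE ?(ltW p10)//.
    have tp : 0 <= t * psi x by rewrite mulr_ge0// ltW.
    by rewrite /v /= !ger0_norm ?lerDl// addr_ge0.
have := energy_lower_bound i0 cK Kr (ltW l0) p0 b0 IE sv vv s0 mv.
rewrite (energyD lambda t (ta k).1 va sp vp).
have h1 := phiE k del del0; have h2 := HN3 k k3.
have h3 : \int[mu]_x (a k x * L x) < - d.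
  by case: (cE k) => //; rewrite ltnNge k1.
rewrite -/Ep -/L.
have h4 := ltr_pM2l t0 (\int[mu]_x (a k x * L x)) (- d).
have h5 : t * \int[mu]_x (a k x * L x) < t * - d by rewrite h4.
have h6 : t ^+ 2 * Ep = t * (d - t) by rewrite -tE; ring.
rewrite h6 -/(a k) in h1 *.
have h7 : 0 <= t ^+ 2 by exact: sqr_ge0.
lra.
Qed.

(** The integrand of [minimizer_supersolution] is nonnegative, so it vanishes
    almost everywhere, and its second factor is nonzero on [M] where
    [|x - z|^2 < S]; the sets obtained for integers [S] cover [M]. *)
Lemma no_minimizer : False.
Proof.
have H S : 0 < S -> {ae mu, forall x, M x -> sqdist z x < S -> normc (u x) = 0}.
  move=> S0; have [psi [sp vp psi0 Lp Lp']] := barrier z l0 rho0 S0.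
  have LM x : M x -> schrodinger lambda psi x <= 0 by move=> /Kz /Lp.
  have I0 := minimizer_supersolution sp vp psi0 LM.
  have mL : measurable_fun M (schrodinger lambda psi).
    apply: measurable_funTS; apply: continuous_measurable_rV.
    exact/smooth_continuous/smooth_schrodinger.
  have mf : measurable_fun M
      (fun x => (normc (u x) * - schrodinger lambda psi x)%:E).
    apply/measurable_EFinP; apply: measurable_funM; last exact: measurable_funN.
    exact: measurable_normc.
  have : ae_eq mu M
      (fun x => (normc (u x) * - schrodinger lambda psi x)%:E) (cst 0%E).
    apply/(ae_eq_integral_abs mu mM mf).1; rewrite -[RHS]I0.
    apply: eq_integral => x; rewrite inE => Mx; rewrite gee0_abs// lee_fin.
    by rewrite mulr_ge0 ?normc_ge0// oppr_ge0 LM.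
  apply: filterS => x Hx Mx xS; have := Hx Mx => -[] /eqP.
  rewrite mulf_eq0 oppr_eq0 => /orP[/eqP//|/eqP L0].
  have rx : rho <= sqdist z x by exact: Kz.
  by have := Lp' x; rewrite rx xS L0 ltxx => /(_ isT).
have {}H : {ae mu, forall x, M x -> normc (u x) = 0}.
  have : {ae mu, forall x (m : nat),
      M x -> sqdist z x < m.+1%:R -> normc (u x) = 0}.
    by apply: ae_foralln => m; exact: H.
  apply: filterS => x Hx Mx; apply: (Hx (Num.truncn (sqdist z x))) => //.
  exact: truncnS_gt.
have : J_ p M u = 0%E.
  rewrite /J_ -[RHS](@integral0 _ _ _ mu M); apply: ge0_ae_eq_integral => //.
  - apply/measurable_EFinP.
    apply: (@measurableT_comp _ _ _ _ _ _ (fun y : R => y `^ (p + 1))).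
      exact: measurable_powR.
    exact: measurable_normc.
  - by move=> x _; rewrite lee_fin powR_ge0.
  - apply: filterS H => x Hx Mx; rewrite Hx// powR0// gt_eqF// addr_gt0//.
by rewrite Ju => -[]; apply/eqP; rewrite gt_eqF.
Qed.

End nonexistence.

(** * Exterior domains *)

Section exterior_domain.
Context {R : realType} {n : nat}.
Local Notation V := 'rV[R]_n.

Lemma F_fin_num lambda (M : set V) (u : V -> R[i]) : open M -> H10 M u ->
  F_ lambda M u \is a fin_num.
Proof.
move=> oM [H1u _]; have mM := open_measurable_rV oM.
have [L2u _] := H1u.
have fL w : L2 M w -> L2norm_sqr M w \is a fin_num.
  move=> [_ _ w2]; rewrite ge0_fin_numE//; apply: integral_ge0 => x _.
  by rewrite lee_fin sqr_ge0.
rewrite /F_ fin_numD fin_numM ?fL// andbT.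
rewrite /grad_norm_sqr; under eq_integral do rewrite -sumEFin.
have L2g i : L2 M (nabla M u i) by have [] := nablaP H1u i.
rewrite ge0_integral_sum//; last 2 first.
- move=> i; have [mr mi _] := L2g i.
  by apply/measurable_EFinP; exact: measurable_normc_sqr.
- by move=> i x _; rewrite lee_fin sqr_ge0.
by apply/sum_fin_numP => i _ _; exact: fL.
Qed.

(** What the argument uses of [K]: it is closed and bounded, and contains a
    ball, namely one inside the open set of which it is the closure. *)
Lemma smoothly_bounded_compactP (K : set V) : K !=set0 ->
  smoothly_bounded_compact K ->
  [/\ closed K, (exists r, forall x, K x -> `|x| <= r) &
      exists z rho, 0 < rho /\ forall x, ~ K x -> rho <= sqdist z x].
Proof.
move=> [y Ky] [U [opU [r [_ rO]] _ KE]].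
have UK : U `<=` K by rewrite KE; exact: subset_closure.
split.
- by rewrite KE; exact: closed_closure.
- exists (r + 1) => x; rewrite KE => Kx.
  have : closure [set x : V | `|x| <= r + 1] x.
    apply: closure_subset Kx => w Uw /=; apply: rO => //.
    by rewrite ltrDl.
  exact: (@closed_norm_ball R n (r + 1)).
- have [z Uz] : U !=set0.
    by apply/set0P/eqP => U0; move: Ky; rewrite KE U0 closure0.
  have /nbhs_ballP[e /= e0 ze] : nbhs z U by exact: open_nbhs_nbhs.
  exists z, (e ^+ 2); split; first exact: exprn_gt0.
  move=> x Kx; rewrite leNgt; apply/negP => xe; apply/Kx/UK/ze.
  split=> // j i; rewrite (ord1 j) /ball /= distrC.
  rewrite -(@ltr_sqr _ _ e) ?nnegrE ?(ltW e0)// real_normK ?num_real//.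
  apply: le_lt_trans xe; rewrite /sqdist (bigD1 i)//= lerDl sumr_ge0// => k _.
  exact: sqr_ge0.
Qed.

End exterior_domain.

Theorem proposition2p3p1 (R : realType) (n : nat) (hn : (2 <= n)%N)
  (K : set 'rV[R]_n) (K0 : K !=set0) (hK : smoothly_bounded_compact K)
  (lambda beta p : R) (lambda0 : 0 < lambda) (beta0 : 0 < beta)
  (p1 : 1 < p) (hp : (2 < n)%N -> p < 1 + 4 / (n%:R - 2)) :
  ~ exists u : 'rV[R]_n -> R[i],
      [/\ H10 (~` K) u,
          J_ p (~` K) u = beta%:E &
          F_ lambda (~` K) u = I_ lambda p beta (~` K)].
Proof.
move=> [u [Hu Ju Fu]].
have [cK [r Kr] [z [rho [rho0 Kz]]]] := smoothly_bounded_compactP K0 hK.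
have oM : open (~` K) by exact: closed_openC.
have FE := fineK (F_fin_num lambda oM Hu).
have p0 : 0 < p by apply: lt_trans p1.
have n0 : (0 < n)%N by apply: leq_trans hn.
apply: (no_minimizer (Ordinal n0) cK Kr rho0 Kz lambda0 beta0 p0 Hu Ju (esym FE)).
by rewrite -Fu FE.
Qed.
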